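(* Let $a_1,a_2,a_3$ be a planar complex analytic billiard with three mirrors. Then it is not $3$-reflective. That is, there is no non-empty open set of pairs $(A_1,A_2)\in a_1\times a_2$ all of which extend to $3$-periodic billiard orbits $A_1A_2A_3$.
   Context: Let $\mathbb{C}^2\subset\mathbb{CP}^2$ be the standard affine chart, equipped with the complex-bilinear quadratic form $dz_1^2+dz_2^2$ (the complexified Euclidean metric); the infinity line is $\mathbb{CP}^2\setminus\mathbb{C}^2$. The isotropic points at infinity are $I_1=(1:i:0)$ and $I_2=(1:-i:0)$. A complex projective line in $\mathbb{CP}^2$ is isotropic if it passes through $I_1$ or $I_2$ (equivalently, it is the infinity line or the quadratic form vanishes on it). The symmetry with respect to a non-isotropic complex line $L$ is the unique non-trivial complex-isometric involution of $\mathbb{C}^2$ fixing the points of $L$; it extends to a projective transformation of $\mathbb{CP}^2$. For $x\in L$, two lines through $x$ are symmetric with respect to $L$ if the symmetry maps one to the other. A planar complex analytic billiard is a finite collection of complex analytic curves (''mirrors'') $a_1,\dots,a_k$ in $\mathbb{CP}^2$ (not necessarily closed or distinct), none of which is an isotropic line. Indices are cyclic: $a_0=a_k$, $a_{k+1}=a_1$. A $k$-periodic billiard orbit is a collection of points $A_j\in a_j$, with $A_{k+1}=A_1$, $A_0=A_k$, such that for every $j=1,\dots,k$: $A_j\neq A_{j+1}$; the tangent line $T_{A_j}a_j$ is not isotropic; and the complex lines $A_{j-1}A_j$ and $A_jA_{j+1}$ are transverse to $T_{A_j}a_j$ (distinct from it) and are symmetric to each other with respect to it. (Each point $A_j$ is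 taken together with a prescribed branch of $a_j$ at $A_j$, which specifies $T_{A_j}a_j$ when $A_j$ is a self-intersection point.) The billiard is $k$-reflective if there exists a non-empty open set of pairs $(A_1,A_2)\in a_1\times a_2$ that extend to $k$-periodic orbits $A_1\dots A_k$. *)

(* Defs.v *)
From HB Require Import structures.
From mathcomp Require Import all_boot all_order all_algebra.
From mathcomp Require Import complex.
From mathcomp Require Import all_classical all_reals all_analysis.

Set Implicit Arguments.
Unset Strict Implicit.
Unset Printing Implicit Defensive.

Import Order.TTheory GRing.Theory Num.Theory.
Import numFieldNormedType.Exports.

Local Open Scope classical_set_scope.
Local Open Scope ring_scope.

(* Presenting R[i] as a numClosedFieldType gives it the topology of its
   modulus, through the canonical instances of numFieldNormedType. *)
Definition Cplx (R : realType) : numClosedFieldType := R[i].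

Definition analytic_at (R : realType) (g : Cplx R -> Cplx R) (z : Cplx R) :=
  exists u : nat -> Cplx R,
    \forall w \near z, series (fun n => u n * (w - z) ^+ n) @ \oo --> g w.

Record chart (R : realType) (S : topologicalType) := Chart {
  chart_dom : set S ;
  chart_map :> S -> Cplx R ;
  chart_open_dom : open chart_dom ;
  chart_continuous : {within chart_dom, continuous chart_map} ;
  chart_injective : {in chart_dom &, injective chart_map} ;
  chart_open_map : forall V : set S,
    open V -> V `<=` chart_dom -> open (chart_map @` V)
}.

Record riemann_surface (R : realType) := RiemannSurface {
  carrier :> topologicalType ;
  carrier_hausdorff : hausdorff_space carrier ;
  carrier_countable : @second_countable carrier ;
  atlas : set (chart R carrier) ;
  atlas_cover : forall p : carrier, exists2 c, atlas c & chart_dom c p ;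
  atlas_compat : forall (c c' : chart R carrier) (p : carrier),
    atlas c -> atlas c' -> chart_dom c p -> chart_dom c' p ->
    exists2 g : Cplx R -> Cplx R,
      analytic_at g (c p) & \forall q \near p, c' q = g (c q)
}.

(* Homogeneous coordinates are (z1 : z2 : z0): the affine point (z1, z2) is
   (z1 : z2 : 1) and the infinity line is z0 = 0.  Points and lines are the
   linear subspaces of C^3 of dimension 1 and 2, so that incidence is
   inclusion and the line through p <> q is the sum p + q. *)
Definition CP2 (R : realType) :=
  {p : {vspace 'rV[Cplx R]_3} | \dim p == 1%N}.

Definition is_line (R : realType) (L : {vspace 'rV[Cplx R]_3}) :=
  \dim L = 2%N.

Definition line_through (R : realType) (p q : CP2 R) :
  {vspace 'rV[Cplx R]_3} := (val p + val q)%VS.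

Definition affine_pt (R : realType) (z : 'rV[Cplx R]_2) : 'rV[Cplx R]_3 :=
  row_mx z (1%:M : 'M[Cplx R]_1).

Definition infinite_pt (R : realType) (z : 'rV[Cplx R]_2) : 'rV[Cplx R]_3 :=
  row_mx z (0 : 'M[Cplx R]_1).

Definition I1 (R : realType) : 'rV[Cplx R]_3 :=
  infinite_pt (\row_(j < 2) (if j == 0 then 1 else 'i)).
Definition I2 (R : realType) : 'rV[Cplx R]_3 :=
  infinite_pt (\row_(j < 2) (if j == 0 then 1 else - 'i)).

Definition isotropic (R : realType) (L : {vspace 'rV[Cplx R]_3}) :=
  (I1 R \in L) \/ (I2 R \in L).

Definition quad_form (R : realType) (z : 'rV[Cplx R]_2) : Cplx R :=
  z 0 0 ^+ 2 + z 0 1 ^+ 2.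

(* The projective extension, acting on row vectors, of the affine map
   z |-> z *m M + v. *)
Definition affine_mx (R : realType) (M : 'M[Cplx R]_2) (v : 'rV[Cplx R]_2) :
  'M[Cplx R]_3 := block_mx M 0 v (1%:M : 'M[Cplx R]_1).

Definition complex_isometry (R : realType) (P : 'M[Cplx R]_3) :=
  exists (M : 'M[Cplx R]_2) (v : 'rV[Cplx R]_2),
    P = affine_mx M v /\ forall z, quad_form (z *m M) = quad_form z.

Definition is_symmetry (R : realType) (L : {vspace 'rV[Cplx R]_3})
    (P : 'M[Cplx R]_3) :=
  [/\ complex_isometry P, P *m P = 1%:M, P <> 1%:M
    & forall z, affine_pt z \in L -> affine_pt z *m P = affine_pt z].

Definition symmetric_lines (R : realType)
    (L l l' : {vspace 'rV[Cplx R]_3}) :=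
  exists2 P : 'M[Cplx R]_3, is_symmetry L P
    & (linfun (mulmxr P : 'rV_3 -> 'rV_3) @: l)%VS = l'.

Definition holomorphic_map (R : realType) (S : riemann_surface R)
    (f : S -> CP2 R) :=
  forall (p : S) (c : chart R S), atlas c -> chart_dom c p ->
  exists F : Cplx R -> 'rV[Cplx R]_3,
    (forall j, analytic_at (fun z => F z 0 j) (c p)) /\
    \forall q \near p, val (f q) = <[F (c q)]>%VS.

(* A curve is carried by a Riemann surface (its normalization), whose points
   are the points of the curve together with a branch there.  It may be
   reducible: the surface is not required to be connected, so the map is
   required to be non-constant near every point. *)
Record analytic_curve (R : realType) := AnalyticCurve {
  surface :> riemann_surface R ;
  curve_map : surface -> CP2 R ;
  curve_holomorphic : holomorphic_map curve_map ;
  curve_nonconstant :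
    forall p : surface, ~ \forall q \near p, curve_map q = curve_map p
}.

Definition line_of (R : realType) (l : 'cV[Cplx R]_3) :
  {vspace 'rV[Cplx R]_3} := lker (linfun (mulmxr l : 'rV_3 -> 'rV_1)).

(* L is the limit of the secants through s; this is also meaningful at the
   singular points (cusps) of a branch.  Convergence of lines is that of
   suitable homogeneous coordinates in the dual plane. *)
Definition tangent_line (R : realType) (a : analytic_curve R) (s : a)
    (L : {vspace 'rV[Cplx R]_3}) :=
  exists (l : a -> 'cV[Cplx R]_3) (l0 : 'cV[Cplx R]_3),
    [/\ l0 != 0, L = line_of l0, l @ s^' --> l0
      & \forall q \near s^',
          line_through (curve_map s) (curve_map q) = line_of (l q)].

Record mirror (R : realType) := Mirror {
  mirror_curve :> analytic_curve R ;
  mirror_not_isotropic : forall L : {vspace 'rV[Cplx R]_3},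
    is_line L -> isotropic L ->
    ~ forall s : mirror_curve, (val (curve_map s) <= L)%VS
}.

Definition billiard (R : realType) (k : nat) := 'I_k -> mirror R.

Definition reflects (R : realType) (k : nat) (a : billiard R k)
    (s : forall j : 'I_k, a j) (j : 'I_k) :=
  let A i := curve_map (s i) in
  let incoming := line_through (A (ord_pred j)) (A j) in
  let outgoing := line_through (A j) (A (ordS j)) in
  exists T : {vspace 'rV[Cplx R]_3},
    [/\ tangent_line (s j) T, ~ isotropic T,
        incoming <> T, outgoing <> T
      & symmetric_lines T incoming outgoing].

Definition periodic_orbit (R : realType) (k : nat) (a : billiard R k)
    (s : forall j : 'I_k, a j) :=
  forall j : 'I_k,
    curve_map (s j) <> curve_map (s (ordS j)) /\ reflects s j.

Definition first_ix (k : nat) : 'I_k.+2 := ord0.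
Definition second_ix (k : nat) : 'I_k.+2 := Ordinal (isT : (1 < k.+2)%N).

Definition reflective (R : realType) (k : nat) (a : billiard R k.+2) :=
  exists U : set (a (first_ix k) * a (second_ix k)),
    [/\ open U, U !=set0
      & forall x, U x ->
        exists s : forall j : 'I_k.+2, a j,
          [/\ periodic_orbit s, s (first_ix k) = x.1
            & s (second_ix k) = x.2]].

(* Main.v *)
Require Import Defs.
From mathcomp Require Import all_boot all_order all_algebra.
From mathcomp Require Import complex.
From mathcomp Require Import all_classical all_reals all_analysis.
From mathcomp Require Import ring lra.
Set Implicit Arguments.
Unset Strict Implicit.
Unset Printing Implicit Defensive.
Import Order.TTheory GRing.Theory Num.Theory.
Import numFieldNormedType.Exports.
Local Open Scope classical_set_scope.
Local Open Scope ring_scope.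

(** Write the points of the affine plane in the isotropic coordinates
    z = x + iy and w = x - iy, in which the quadratic form is zw.  A line has a
    slope dz/dw, finite and non-zero when the line is not isotropic, and two
    lines of slopes d and d' are symmetric with respect to a line of slope m
    exactly when d d' = m^2.  Thus in a triangular orbit whose first two
    mirrors have slopes m1, m2 and whose side A1 A2 has slope D, the other
    sides have slopes m1^2 / D and m2^2 / D; this makes A3 a rational function
    of the two parameters t, u of A1, A2, and it makes the slope of the third
    mirror a square root of (m1 m2 / D)^2.

    When A1 moves and A2 is fixed, A3 moves along its mirror, so its velocity
    has slope e m1 m2 / D with e = 1 or e = -1.  The derivatives of the
    reflection laws at A1 and A2 then determine the curvature of the first
    mirror from the triangle ([curvature_defect_of_velocity]); for e = 1 this
    is the classical identity k = 2 (sin a)^3 / P, where k is the curvature, P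
    the perimeter of the orbit and a the angle of the side with the mirror.
    But the curvature at A1 does not depend on A2.
    Differentiating the identity in u, and eliminating the curvature of the
    second mirror by the same identity at A2, leaves an algebraic relation
    between D, m1 and m2 ([log_derivative]).  Up to exchanging the two mirrors
    there are three combinations of signs.  For the signs (1, 1) the relation
    is already impossible; for (-1, -1) and (1, -1) its own derivative in u
    makes it so.  In each case it would force D = - m1: the side would be
    normal to the mirror, and then two vertices would coincide
    ([apex_nondegenerate]).

    The third vertex is only known to lie, for each (t, u), on some branch of
    the third mirror, with no continuity of the branch.  That its velocity is
    tangent to this branch comes from a cardinality argument: for an arbitrary
    map from a disc to a second countable space, some parameter t0 of the disc
    is a limit of other parameters whose values tend to the value at t0
    ([recurrent_parameter]), and the tangent line of the branch is the limit of
    the secants so obtained ([tangent_derivative]).  Hence the product of the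
    two curvature identities (e = 1 and e = -1) holds on a dense set, and
    everywhere by continuity; one of its factors vanishes on a smaller box.

    The computation supposes m1^2 <> m2^2.  If m1^2 = m2^2 on a whole box, the
    sides at A3 are parallel, so A3 runs along the infinity line, which is then
    tangent to the third mirror although it is isotropic ([no_parallel]). *)

(** * The curvature identity and its algebraic consequences *)

Section Alg.
Variable F : numFieldType.
Implicit Types z w p m n D c e : F.

(** Here D is the slope of the side, c the difference of the coordinates w of
    its ends, and, for the mirror at the first end, m1 is the slope, p1 and n1
    the derivatives of the coordinate w and of the slope; m2 is the slope of the
    other mirror.  The equation says that n1 / p1, a multiple of the curvature,
    has the value that the triangle imposes for the sign e. *)
Definition curvature_defect e D c m1 p1 n1 m2 : F :=
  p1 * (D - m1) ^+ 2 * (m1 + e * m2) - 2 * n1 * c * D * (D - e * m2).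

Lemma sqr_neq_factors (x y : F) : x ^+ 2 != y ^+ 2 -> (x - y != 0) /\ (x + y != 0).
Proof. by rewrite -subr_eq0 subr_sqr mulf_eq0 negb_or => /andP[]. Qed.

(** The vertex A3 = (z3, w3) satisfies the reflection laws at A1 and A2, and so
    does its velocity (zt, wt) after differentiation in the parameter of A1.
    The last hypothesis is the reflection law at A3 for a mirror directed by the
    velocity: it leaves only the sign e = 1 or e = -1 undetermined. *)
Lemma curvature_defect_of_velocity z1 w1 p1 m1 n1 z2 w2 m2 z3 w3 zt wt :
  let D := (z2 - z1) / (w2 - w1) in
  z2 - z1 != 0 -> w2 - w1 != 0 -> m1 != 0 -> m2 != 0 ->
  m1 ^+ 2 != m2 ^+ 2 -> D ^+ 2 != m1 ^+ 2 -> D ^+ 2 != m2 ^+ 2 ->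
  (z3 - z1) * (z2 - z1) = m1 ^+ 2 * (w3 - w1) * (w2 - w1) ->
  (z3 - z2) * (z2 - z1) = m2 ^+ 2 * (w3 - w2) * (w2 - w1) ->
  (zt - m1 * p1) * (z2 - z1) - (z3 - z1) * (m1 * p1) =
    2 * m1 * n1 * (w3 - w1) * (w2 - w1) + m1 ^+ 2 * (wt - p1) * (w2 - w1)
    - m1 ^+ 2 * (w3 - w1) * p1 ->
  zt * (z2 - z1) - (z3 - z2) * (m1 * p1) =
    m2 ^+ 2 * wt * (w2 - w1) - m2 ^+ 2 * (w3 - w2) * p1 ->
  zt ^+ 2 * ((w1 - w3) * (w2 - w3)) = wt ^+ 2 * ((z1 - z3) * (z2 - z3)) ->
  curvature_defect 1 D (w2 - w1) m1 p1 n1 m2 = 0 \/ curvature_defect (-1) D (w2 - w1) m1 p1 n1 m2 = 0.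
Proof.
move=> D dz0 dw0 m10 m20 m12 Dm1 Dm2.
have D0 : D != 0 by rewrite mulf_neq0 ?invr_eq0.
have ez : z2 - z1 = D * (w2 - w1) by rewrite /D divfK.
have [m12a m12b] := sqr_neq_factors m12; have [Dm1a Dm1b] := sqr_neq_factors Dm1.
have [Dm2a Dm2b] := sqr_neq_factors Dm2.
have m12c : m2 ^+ 2 - m1 ^+ 2 != 0 by rewrite subr_eq0 eq_sym.
rewrite ez; move: dw0; set c := w2 - w1 => c0.
(* The three differences of the coordinate w along the sides are proportional
   to the differences of squares of D, m1, m2; the factor is k. *)
pose k := c / (m2 ^+ 2 - m1 ^+ 2).
have k0 : k != 0 by rewrite mulf_neq0 ?invr_eq0.
have ck : c = k * (m2 ^+ 2 - m1 ^+ 2) by rewrite /k divfK.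
have -> : z3 - z1 = (z3 - z2) + D * c by rewrite -ez; ring.
have -> : w3 - w1 = (w3 - w2) + c by rewrite /c; ring.
have -> : w1 - w3 = - ((w3 - w2) + c) by rewrite /c; ring.
have -> : z1 - z3 = - ((z3 - z2) + D * c) by rewrite -ez; ring.
have -> : w2 - w3 = - (w3 - w2) by ring.
have -> : z2 - z3 = - (z3 - z2) by ring.
move: (z3 - z2) (w3 - w2) => A a E1 E2 dE1 dE2 S3.
have eA : A = m2 ^+ 2 * a / D.
  by apply: (mulIf (mulf_neq0 D0 c0)); rewrite E2; field.
have ea : a = k * (m1 ^+ 2 - D ^+ 2).
  have : (A * D + D ^+ 2 * c) * c = m1 ^+ 2 * (a + c) * c by rewrite -E1; ring.
  move/(mulIf c0); rewrite eA divfK // => H.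
  apply: (mulIf m12c).
  have -> : k * (m1 ^+ 2 - D ^+ 2) * (m2 ^+ 2 - m1 ^+ 2) = c * (m1 ^+ 2 - D ^+ 2).
    by rewrite [in RHS]ck; ring.
  have -> : a * (m2 ^+ 2 - m1 ^+ 2) =
     (m2 ^+ 2 * a + D ^+ 2 * c) - m1 ^+ 2 * (a + c) + c * (m1 ^+ 2 - D ^+ 2) by ring.
  by rewrite H subrr add0r.
have a0 : a != 0.
  by rewrite ea mulf_neq0 // subr_eq0 eq_sym.
have eb : a + c = - k * (D ^+ 2 - m2 ^+ 2) by rewrite ea ck; ring.
have b0 : a + c != 0 by rewrite eb mulf_neq0 ?oppr_eq0 // subr_eq0.
have eB : A + D * c = m1 ^+ 2 * (a + c) / D.
  by apply: (mulIf (mulf_neq0 D0 c0)); rewrite E1; field.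
have : (zt * D - m1 * m2 * wt) * (zt * D + m1 * m2 * wt) = 0.
  apply: (mulIf (mulf_neq0 a0 b0)); rewrite mul0r.
  have -> : (zt * D - m1 * m2 * wt) * (zt * D + m1 * m2 * wt) * (a * (a + c)) =
     (zt ^+ 2 * (- (a + c) * - a)) * D ^+ 2 - wt ^+ 2 * (m1 * m2) ^+ 2 * (a * (a + c)) by ring.
  rewrite S3 eB eA; field; exact: D0.
suff H e : e ^+ 2 = 1 -> zt * D = e * m1 * m2 * wt -> curvature_defect e D c m1 p1 n1 m2 = 0.
  move=> /eqP; rewrite mulf_eq0 => /orP[]/eqP H0; [left|right]; apply: H.
  - by rewrite expr1n.
  - by apply/eqP; rewrite mul1r -subr_eq0 H0.
  - by rewrite sqrrN expr1n.
  - by apply/eqP; rewrite -subr_eq0 !mulN1r !mulNr opprK H0.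
move=> e2 ev.
have ezt : zt = e * m1 * m2 * wt / D by rewrite -ev mulfK.
(* The derivative of the law at A2 gives wt; that of the law at A1 then gives
   n1. *)
have F2 : c * wt * (e * m1 - m2) * D = m2 * a * p1 * (m1 - D).
  apply: (mulIf (mulf_neq0 m20 D0)).
  have -> : c * wt * (e * m1 - m2) * D * (m2 * D) =
     ((zt * (D * c)) - m2 ^+ 2 * wt * c) * D ^+ 2 by rewrite ezt; field; exact: D0.
  have -> : zt * (D * c) = A * (m1 * p1) + (m2 ^+ 2 * wt * c - m2 ^+ 2 * a * p1).
    by rewrite -dE2; ring.
  by rewrite eA; field; exact: D0.
have F1 : c * wt * (e * m2 - m1) * D =
    p1 * (D - m1) * (D * c - m1 * (a + c)) + 2 * n1 * (a + c) * c * D.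
  apply: (mulIf m10).
  have -> : c * wt * (e * m2 - m1) * D * m1 =
     zt * (D * c) * D - m1 ^+ 2 * wt * c * D by rewrite ezt; field; exact: D0.
  have -> : zt * (D * c) = (zt - m1 * p1) * (D * c) - (A + D * c) * (m1 * p1)
     + (m1 * p1) * (D * c) + (A + D * c) * (m1 * p1) by ring.
  by rewrite dE1 eB; field; exact: D0.
have F3 : 2 * n1 * (a + c) * c * D =
   - (p1 * (D - m1) * (D * c - m1 * (a + c) - e * m2 * a)).
  have : c * wt * (e * m2 - m1) * D = - e * (m2 * a * p1 * (m1 - D)).
    rewrite -F2; have -> : - e * (c * wt * (e * m1 - m2) * D) =
      c * wt * (e * m2 - e ^+ 2 * m1) * D by ring.
    by rewrite e2 mul1r.
  rewrite F1 => H.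
  have -> : 2 * n1 * (a + c) * c * D =
    (p1 * (D - m1) * (D * c - m1 * (a + c)) + 2 * n1 * (a + c) * c * D)
     - (p1 * (D - m1) * (D * c - m1 * (a + c))) by ring.
  by rewrite H; ring.
have s0 : - k * (D + e * m2) != 0.
  rewrite mulf_neq0 ?oppr_eq0 //.
  apply: contra Dm2 => /eqP H.
  rewrite -subr_eq0 -[m2 ^+ 2]mul1r -e2 -exprMn subr_sqr H mulr0 //.
apply: (mulIf s0); rewrite mul0r /curvature_defect.
have -> : (p1 * (D - m1) ^+ 2 * (m1 + e * m2) - 2 * n1 * c * D * (D - e * m2)) *
  (- k * (D + e * m2)) =
  - (2 * n1 * (- k * (D ^+ 2 - e ^+ 2 * m2 ^+ 2)) * c * D) -
   p1 * (D - m1) * (k * ((D - m1) * (m1 + e * m2) * (D + e * m2))) by ring.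
rewrite e2 mul1r -eb F3.
have -> : D * c - m1 * (a + c) - e * m2 * a =
   k * ((D - m1) * (m1 + e * m2) * (D + e * m2)) - k * (e ^+ 2 - 1) * (D - m1) * m2 ^+ 2.
  rewrite eb ck ea; ring.
rewrite e2; ring.
Qed.

(** The derivative of [curvature_defect] along a motion of the second end, which
    changes D, c and m2 at the rates D', c' and m2'. *)
Definition curvature_defect_derivative e D c m1 p1 n1 m2 D' c' m2' : F :=
  p1 * (2 * (D - m1) * D' * (m1 + e * m2) + (D - m1) ^+ 2 * (e * m2'))
  - 2 * n1 * (c' * D * (D - e * m2) + c * D' * (D - e * m2) + c * D * (D' - e * m2')).

Lemma sqr_neq_signed_factors (s : bool) (x y : F) : x ^+ 2 != y ^+ 2 ->
  (x - (-1) ^+ s * y != 0) /\ (x + (-1) ^+ s * y != 0).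
Proof.
case/sqr_neq_factors => a b; case: s; rewrite ?expr0 ?expr1 ?mul1r ?mulN1r ?opprK //.
Qed.

(** The quantities n1 and n2 of the two mirrors are eliminated by the two
    curvature identities; what is left of the derivative of the first one is
    homogeneous in D, m1, m2 alone. *)
Lemma log_derivative (s1 s2 : bool) D c m1 p1 n1 m2 p2 n2 :
  let e1 := (-1) ^+ s1 in let e2 := (-1) ^+ s2 in
  D != 0 -> c != 0 -> p1 != 0 -> p2 != 0 ->
  m1 ^+ 2 != m2 ^+ 2 -> D ^+ 2 != m1 ^+ 2 -> D ^+ 2 != m2 ^+ 2 ->
  curvature_defect e1 D c m1 p1 n1 m2 = 0 -> curvature_defect e2 D (- c) m2 p2 n2 m1 = 0 ->
  curvature_defect_derivative e1 D c m1 p1 n1 m2 (p2 * (m2 - D) / c) p2 n2 = 0 ->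
  n2 = - (p2 * (D - m2) ^+ 2 * (m2 + e2 * m1) / (2 * c * D * (D - e2 * m1))) /\
  2 * (D - e2 * m1) * (- 4 * D * (D - m2) * (D - e1 * m2)
     + 2 * (D - m1) * (- D * (D - e1 * m2) + (D - m2) * (D - e1 * m2) + (D - m2) * D)) *
     (m1 + e1 * m2)
  - 2 * e1 * (D - m1) * (D - m2) ^+ 2 * (m2 + e2 * m1) * (D + m1) = 0.
Proof.
move=> e1 e2 D0 c0 p10 p20 m12 Dm1 Dm2.
have m21 : m2 ^+ 2 != m1 ^+ 2 by rewrite eq_sym.
have [m12a m12b] := sqr_neq_signed_factors s1 m12; have [_ m21b] := sqr_neq_signed_factors s2 m21.
have [Dm1a Dm1b] := sqr_neq_signed_factors s2 Dm1; have [Dm2a Dm2b] := sqr_neq_signed_factors s1 Dm2.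
have [Dm1c _] := sqr_neq_factors Dm1; have [Dm2c _] := sqr_neq_factors Dm2.
have e1e : e1 ^+ 2 = 1 by rewrite sqrr_sign.
rewrite -/e1 -/e2 in m12a m12b m21b Dm1a Dm1b Dm2a Dm2b *.
rewrite /curvature_defect => R1 R2 dR.
have en1 : n1 = p1 * (D - m1) ^+ 2 * (m1 + e1 * m2) / (2 * c * D * (D - e1 * m2)).
  have H : 2 * c * D * (D - e1 * m2) != 0 by rewrite !mulf_neq0 ?pnatr_eq0.
  apply: (mulIf H); rewrite divfK //; move/eqP: R1; rewrite subr_eq0 => /eqP ->; ring.
have en2 : n2 = - (p2 * (D - m2) ^+ 2 * (m2 + e2 * m1) / (2 * c * D * (D - e2 * m1))).
  have H : 2 * c * D * (D - e2 * m1) != 0 by rewrite !mulf_neq0 ?pnatr_eq0.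
  apply: (mulIf H); rewrite mulNr divfK //; move/eqP: R2; rewrite subr_eq0 => /eqP ->; ring.
split=> //; move: dR; rewrite /curvature_defect_derivative en1 en2 => dR.
have H : p1 * p2 * (D - m1) / (c * D * 2 * (D - e1 * m2) * (D - e2 * m1)) != 0.
  by rewrite !(mulf_neq0, invr_eq0) ?pnatr_eq0.
apply: (mulIf H); rewrite mul0r -[in RHS](mulr0 2) -[in RHS]dR.
by field; rewrite ?D0 ?c0 ?Dm2a ?Dm1a ?pnatr_eq0.
Qed.

(** For the signs (1, 1) the relation of [log_derivative] is a product of
    factors that a non-degenerate triangle keeps away from zero. *)
Lemma plus_plus_impossible D m1 m2 : m1 + m2 != 0 -> D - m1 != 0 -> D - m2 != 0 -> D + m1 != 0 ->
  2 * (D - 1 * m1) * (- 4 * D * (D - m2) * (D - 1 * m2)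
     + 2 * (D - m1) * (- D * (D - 1 * m2) + (D - m2) * (D - 1 * m2) + (D - m2) * D)) *
     (m1 + 1 * m2)
  - 2 * 1 * (D - m1) * (D - m2) ^+ 2 * (m2 + 1 * m1) * (D + m1) <> 0.
Proof.
move=> h1 h2 h3 h4 /eqP; apply/negP.
rewrite (_ : _ - _ = - (6 * (D - m1) * (m1 + m2) * (D - m2) ^+ 2 * (D + m1))); last by ring.
by rewrite oppr_eq0 !(mulf_neq0, expf_neq0) ?pnatr_eq0.
Qed.

(** For the other signs the relation of [log_derivative] has one factor which is
    a conic in D, m1, m2; the next two lemmas isolate it. *)
Lemma minus_minus_relation D m1 m2 : m1 - m2 != 0 -> D + m2 != 0 -> D + m1 != 0 ->
  2 * (D - -1 * m1) * (- 4 * D * (D - m2) * (D - -1 * m2)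
     + 2 * (D - m1) * (- D * (D - -1 * m2) + (D - m2) * (D - -1 * m2) + (D - m2) * D)) *
     (m1 + -1 * m2)
  - 2 * -1 * (D - m1) * (D - m2) ^+ 2 * (m2 + -1 * m1) * (D + m1) = 0 ->
  D * (m2 - m1) + 3 * m1 * m2 - 3 * D ^+ 2 = 0.
Proof.
move=> h1 h2 h3 H.
have K : 2 * (D + m1) * (m1 - m2) * (D + m2) != 0 by rewrite !mulf_neq0 ?pnatr_eq0.
by apply: (mulIf K); rewrite mul0r -[RHS]H; ring.
Qed.

Lemma plus_minus_relation D m1 m2 : D - m2 != 0 -> D + m1 != 0 ->
  2 * (D - -1 * m1) * (- 4 * D * (D - m2) * (D - 1 * m2)
     + 2 * (D - m1) * (- D * (D - 1 * m2) + (D - m2) * (D - 1 * m2) + (D - m2) * D)) *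
     (m1 + 1 * m2)
  - 2 * 1 * (D - m1) * (D - m2) ^+ 2 * (m2 + -1 * m1) * (D + m1) = 0 ->
  D * (m1 + 3 * m2) + m1 * (3 * m1 + m2) = 0.
Proof.
move=> h1 h2 H.
have K : - (2 * (D + m1) * (D - m2) ^+ 2) != 0.
  by rewrite oppr_eq0 !(mulf_neq0, expf_neq0) ?pnatr_eq0.
by apply: (mulIf K); rewrite mul0r -[RHS]H; ring.
Qed.

(** The conic eliminates m2; its derivative then becomes a multiple of the third
    power of D + m1.  The same happens for the signs (1, -1). *)
Lemma minus_minus_impossible D c m1 m2 p2 n2 : D != 0 -> c != 0 -> p2 != 0 -> D - m2 != 0 -> D + m1 != 0 ->
  n2 = - (p2 * (D - m2) ^+ 2 * (m2 + -1 * m1) / (2 * c * D * (D - -1 * m1))) ->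
  D * (m2 - m1) + 3 * m1 * m2 - 3 * D ^+ 2 = 0 ->
  (p2 * (m2 - D) / c) * (m2 - m1) + D * n2 + 3 * m1 * n2
    - 6 * D * (p2 * (m2 - D) / c) <> 0.
Proof.
move=> D0 c0 p0 y0 s0 en rel dr.
have s0' : D - -1 * m1 != 0 by rewrite mulN1r opprK.
have K : - (p2 * (D - m2) / (2 * c * D * (D + m1))) != 0.
  by rewrite oppr_eq0 !(mulf_neq0, invr_eq0) ?pnatr_eq0.
have {}dr : (m2 - m1) * (2 * D * (D + m1) + (D - m2) * (D + 3 * m1))
     - 12 * D ^+ 2 * (D + m1) = 0.
  apply: (mulIf K); rewrite mul0r -[RHS]dr en; field.
  by rewrite D0 c0 ?pnatr_eq0 ?s0'.
have /eqP : 12 * D * (D + m1) ^+ 3 = 0.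
  rewrite -[RHS](mul0r (- (D + 3 * m1))) -[X in _ = X * _]dr.
  have em : m2 * (D + 3 * m1) = 3 * D ^+ 2 + D * m1.
    by apply/eqP; rewrite -subr_eq0 -rel; apply/eqP; ring.
  have -> : ((m2 - m1) * (2 * D * (D + m1) + (D - m2) * (D + 3 * m1)) - 12 * D ^+ 2 * (D + m1))
     * - (D + 3 * m1) =
    - (m2 * (D + 3 * m1) - m1 * (D + 3 * m1)) *
    (2 * D * (D + m1) + (D * (D + 3 * m1) - m2 * (D + 3 * m1))) + 12 * D ^+ 2 * (D + m1) * (D + 3 * m1) by ring.
  rewrite em; ring.
by apply/negP; rewrite !(mulf_neq0, expf_neq0) ?pnatr_eq0.
Qed.

Lemma plus_minus_impossible D c m1 m2 p2 n2 : D != 0 -> c != 0 -> p2 != 0 -> D - m2 != 0 -> D + m1 != 0 ->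
  m1 != 0 ->
  n2 = - (p2 * (D - m2) ^+ 2 * (m2 + -1 * m1) / (2 * c * D * (D - -1 * m1))) ->
  D * (m1 + 3 * m2) + m1 * (3 * m1 + m2) = 0 ->
  (p2 * (m2 - D) / c) * (m1 + 3 * m2) + D * (3 * n2) + m1 * n2 <> 0.
Proof.
move=> D0 c0 p0 y0 s0 m0 en rel dr.
have s0' : D - -1 * m1 != 0 by rewrite mulN1r opprK.
have K : - (p2 * (D - m2) / (2 * c * D * (D + m1))) != 0.
  by rewrite oppr_eq0 !(mulf_neq0, invr_eq0) ?pnatr_eq0.
have {}dr : 2 * D * (D + m1) * (m1 + 3 * m2) + (D - m2) * (m2 - m1) * (3 * D + m1) = 0.
  apply: (mulIf K); rewrite mul0r -[RHS]dr en; field.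
  by rewrite D0 c0 ?pnatr_eq0 ?s0'.
have /eqP : 12 * m1 * (D + m1) ^+ 3 = 0.
  rewrite -[RHS](mul0r (- (3 * D + m1))) -[X in _ = X * _]dr.
  have em : m2 * (3 * D + m1) = - (D * m1 + 3 * m1 ^+ 2).
    by apply/eqP; rewrite -subr_eq0 -rel; apply/eqP; ring.
  have -> : (2 * D * (D + m1) * (m1 + 3 * m2) + (D - m2) * (m2 - m1) * (3 * D + m1)) * - (3 * D + m1) =
    - (2 * D * (D + m1) * (m1 * (3 * D + m1) + 3 * (m2 * (3 * D + m1))) +
      (D * (3 * D + m1) - m2 * (3 * D + m1)) * (m2 * (3 * D + m1) - m1 * (3 * D + m1))) by ring.
  rewrite em; ring.
by apply/negP; rewrite !(mulf_neq0, expf_neq0) ?pnatr_eq0.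
Qed.

End Alg.

(** * Derivatives over a numeric field *)

Section Deriv.
Variable K : numFieldType.

Lemma is_derive_cvgP (f : K -> K) (x d : K) :
  is_derive x 1 f d <-> h^-1 * (f (h + x) - f x) @[h --> 0^'] --> d.
Proof.
have E : (fun h : K => h^-1 *: ((f \o shift x) (h *: (1 : K)) - f x)) =
         (fun h => h^-1 * (f (h + x) - f x)).
  by apply/funext => h /=; rewrite /GRing.scale /= mulr1.
split=> [[dv de]|H].
  by rewrite -de -E; move: dv; rewrite /derivable /derive; apply.
have H' : h^-1 *: ((f \o shift x) (h *: (1:K)) - f x) @[h --> 0^'] --> d by rewrite E.
apply: DeriveDef; first by apply/cvg_ex; exists d.
by apply: cvg_lim => //; exact: norm_hausdorff.
Qed.

Lemma is_derive_of_quadratic_bound (f : K -> K) (x d A r : K) : 0 < r -> 0 <= A ->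
  (forall h, `|h| < r -> `|f (h + x) - f x - h * d| <= A * `|h| ^+ 2) ->
  is_derive x 1 f d.
Proof.
move=> r0 A0 H; apply/is_derive_cvgP/cvgrPdist_le => e e0.
have A1 : 0 < A + 1 by rewrite ltr_wpDl.
near=> h.
have h0 : h != 0 by near: h; exact: nbhs_dnbhs_neq.
have hr : `|h| < r by near: h; exact: dnbhs0_lt.
have he : `|h| < e / (A + 1) by near: h; apply: dnbhs0_lt; exact: divr_gt0.
have nh : 0 < `|h| by rewrite normr_gt0.
have -> : d - h^-1 * (f (h + x) - f x) = - (h^-1 * (f (h + x) - f x - h * d)).
  by field.
rewrite normrN normrM normfV ler_pdivrMl //.
apply: le_trans (H h hr) _; rewrite expr2 mulrA mulrC ler_wpM2l //.
rewrite -[e](divfK (lt0r_neq0 A1)).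
apply: (@le_trans _ _ (A * (e / (A + 1)))); first by rewrite ler_wpM2l // ltW.
by rewrite [A * _]mulrC ler_wpM2l ?lerDl // ltW ?divr_gt0.
Unshelve. all: by end_near. Qed.

Lemma is_derive_invf (f : K -> K) (x d : K) : f x != 0 -> is_derive x 1 f d ->
  is_derive x 1 (fun y => (f y)^-1) (- f x ^- 2 * d).
Proof.
move=> fx [dv de]; apply: DeriveDef; first exact: derivableV.
by rewrite deriveV // de.
Qed.

Lemma near_nonzero (T : topologicalType) (f : T -> K) (x : T) :
  {for x, continuous f} -> f x != 0 -> nbhs x [set y | f y != 0].
Proof.
move=> cf fx; apply: (cf [set y | y != 0]).
apply/nbhs_normP; exists `|f x|; first by rewrite /= normr_gt0.
by move=> y; rewrite /ball_ /=; apply: contraTneq => ->; rewrite subr0 ltxx.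
Qed.

Lemma is_derive_continuous (f : K -> K) (x d : K) : is_derive x 1 f d -> {for x, continuous f}.
Proof. by move=> [/derivable1_diffP/differentiable_continuous]. Qed.

End Deriv.

(** * Termwise differentiation of complex power series *)

Section Power.
Variable K : numFieldType.
Implicit Types w h y : K.

(** The factor y^2 on the left avoids the exponent n - 2, which is truncated. *)
Lemma pow_taylor_bound (w h y : K) n : 0 <= y -> `|w| <= y -> `|w + h| <= y ->
  `|(w + h) ^+ n - w ^+ n - n%:R * h * w ^+ n.-1| * y ^+ 2 <=
  (n ^ 2)%:R * `|h| ^+ 2 * y ^+ n.
Proof.
move=> y0 wy why; elim: n => [|n IH].
  by rewrite !expr0 subrr !mul0r subr0 normr0 mul0r.
have -> : (w + h) ^+ n.+1 - w ^+ n.+1 - n.+1%:R * h * w ^+ n.+1.-1 =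
    (w + h) * ((w + h) ^+ n - w ^+ n - n%:R * h * w ^+ n.-1) + n%:R * h ^+ 2 * w ^+ n.-1.
  case: n {IH} => [|n] /=; first by rewrite !expr0 expr1; ring.
  rewrite !exprS -!natr1 expr0; move: ((w + h) ^+ n) (w ^+ n) => a b; ring.
have A : `|(w + h) * ((w + h) ^+ n - w ^+ n - n%:R * h * w ^+ n.-1)| * y ^+ 2 <=
   (n ^ 2)%:R * `|h| ^+ 2 * y ^+ n.+1.
  rewrite normrM; set d := `|_ - _| in IH *; rewrite -[X in X <= _]mulrA.
  have -> : (n ^ 2)%:R * `|h| ^+ 2 * y ^+ n.+1 = y * ((n ^ 2)%:R * `|h| ^+ 2 * y ^+ n).
    by rewrite [y ^+ _]exprS mulrCA.
  by rewrite ler_pM // mulr_ge0 // ?normr_ge0 // exprn_ge0.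
have B : `|n%:R * h ^+ 2 * w ^+ n.-1| * y ^+ 2 <= n%:R * `|h| ^+ 2 * y ^+ n.+1.
  case: n {IH A} => [|n] /=; first by rewrite !mul0r normr0 mul0r.
  have -> : y ^+ n.+2 = y ^+ n * y ^+ 2 by rewrite -exprD addn2.
  rewrite !normrM normr_nat !normrX [X in _ <= X]mulrA ler_wpM2r ?exprn_ge0 //.
  by rewrite ler_wpM2l ?mulr_ge0 ?exprn_ge0 // lerXn2r // nnegrE.
apply: (@le_trans _ _ ((n ^ 2)%:R * `|h| ^+ 2 * y ^+ n.+1 + n%:R * `|h| ^+ 2 * y ^+ n.+1)).
  apply: le_trans (lerD A B); rewrite -mulrDl ler_wpM2r ?exprn_ge0 //; exact: ler_normD.
rewrite -!mulrDl -natrD ler_wpM2r ?exprn_ge0 // ler_wpM2r ?exprn_ge0 // ler_nat.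
by rewrite -[n.+1]addn1 sqrnD muln1 -addnA leq_add2l mul2n -addnn addnA leq_addl.
Qed.

Lemma geometric_half_sum (n : nat) : \sum_(i < n) (2 ^- i : K) <= 2.
Proof.
suff -> : \sum_(i < n) (2 ^- i : K) = 2 - 2 * 2 ^- n.
  by rewrite gerBl mulr_ge0 // invr_ge0 exprn_ge0.
elim: n => [|n IH]; first by rewrite big_ord0 expr0 invr1 mulr1 subrr.
by rewrite big_ord_recr /= IH exprS; field; rewrite expf_neq0.
Qed.

End Power.

Section Cplx.
Variable R : realType.
Local Notation C := (Cplx R).
Local Notation re := (@complex.Re R).
Local Notation im := (@complex.Im R).

Definition ofR (r : R) : C := (r%:C)%C.

Lemma ofR_gt0 (e : C) : 0 < e -> exists2 r : R, 0 < r & e = ofR r.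
Proof.
move=> e0; have : e \is Num.real by rewrite ger0_real // ltW.
case/complex_realP => k ek; exists k => //.
by rewrite -ltcR -ek.
Qed.

Lemma le_ofR (a b : R) : (ofR a <= ofR b) = (a <= b).
Proof. exact: lecR. Qed.
Lemma lt_ofR (a b : R) : (ofR a < ofR b) = (a < b).
Proof. exact: ltcR. Qed.

Lemma norm_ofR (x : R) : `|ofR x| = ofR `|x|.
Proof. by rewrite /ofR (normc_def (x%:C)%C) /= expr0n /= addr0 sqrtr_sqr. Qed.

Lemma norm_i : `|('i%C : R[i]) : C| = 1.
Proof. by rewrite (normc_def 'i%C) /= expr0n /= add0r expr1n sqrtr1. Qed.

Lemma normc_le_ReIm (z : C) : `|z| <= ofR (`|re z| + `|im z|).
Proof.
rewrite {1}[z](complexE (z : R[i])).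
apply: le_trans (ler_normD _ _) _.
by rewrite normrM norm_i mul1r -!/(ofR _) !norm_ofR /ofR rmorphD.
Qed.

Lemma norm_re_le (z : C) : ofR `|re z| <= `|z|.
Proof. exact: (normc_ge_Re (z : R[i])). Qed.

Lemma norm_im_le (z : C) : ofR `|im z| <= `|z|.
Proof.
have := norm_re_le (- (z * ('i%C : R[i])) : C).
have -> : re (- (z * ('i%C : R[i]))) = im z by case: z => a b /=; ring.
by rewrite normrN normrM norm_i mulr1.
Qed.

Lemma cvg_ReIm (T : Type) (F : set_system T) {FF : Filter F} (f : T -> C) (a b : R) :
  re (f x) @[x --> F] --> a -> im (f x) @[x --> F] --> b ->
  f x @[x --> F] --> ((a +i* b)%C : C).
Proof.
move=> Ha Hb; apply/cvgrPdist_le => e /ofR_gt0[r r0 ->].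
near=> x.
apply: le_trans (normc_le_ReIm _) _; rewrite le_ofR.
have A : `|a - re (f x)| <= r / 2.
  by near: x; move/cvgrPdist_le : Ha; apply; rewrite divr_gt0.
have B : `|b - im (f x)| <= r / 2.
  by near: x; move/cvgrPdist_le : Hb; apply; rewrite divr_gt0.
have -> : re (((a +i* b)%C : C) - f x) = a - re (f x) by case: (f x).
have -> : im (((a +i* b)%C : C) - f x) = b - im (f x) by case: (f x).
lra.
Unshelve. all: by end_near. Qed.

Lemma re_sum (u : nat -> C) n : re (series u n) = series (re \o u) n.
Proof.
elim: n => [|n IH]; first by rewrite /series /= !big_geq.
by rewrite !seriesSr /= -IH; case: (series u n) => ? ?; case: (u n).
Qed.

Lemma im_sum (u : nat -> C) n : im (series u n) = series (im \o u) n.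
Proof.
elim: n => [|n IH]; first by rewrite /series /= !big_geq.
by rewrite !seriesSr /= -IH; case: (series u n) => ? ?; case: (u n).
Qed.

Lemma real_series_cvg (v : nat -> R) (M : R) :
  (forall n, `|v n| <= M * 2 ^- n) -> cvgn (series v).
Proof.
move=> H; apply: normed_cvg; apply: (@series_le_cvg _ _ (geometric M 2^-1)) => //.
- by move=> n /=.
- by move=> n; rewrite /geometric /= exprVn; apply: le_trans (H n).
- by move=> n; rewrite /geometric /= exprVn; exact: H.
- by apply: is_cvg_geometric_series; rewrite ger0_norm ?invf_lt1 ?ltr1n.
Qed.

(** Completeness of the complex numbers is obtained from that of the reals, on
    real and imaginary parts. *)
Lemma series_cvg_of_half (u : nat -> C) (M : C) :
  (forall n, `|u n| <= M * 2 ^- n) -> exists l : C, series u @ \oo --> l.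
Proof.
move=> H.
have M0 : 0 <= M by have := H 0%N; rewrite expr0 invr1 mulr1; apply: le_trans.
have [k Mk] : exists k : R, M = ofR k.
  by case/complex_realP: (ger0_real M0) => k ek; exists k.
have HR n : ofR k * 2 ^- n = ofR (k * 2 ^- n).
  by rewrite /ofR rmorphM /= fmorphV rmorphXn /= rmorph_nat.
have cr : cvgn (series (re \o u)).
  apply: (@real_series_cvg _ k) => n; rewrite -le_ofR -HR -Mk.
  exact: le_trans (norm_re_le _) (H n).
have ci : cvgn (series (im \o u)).
  apply: (@real_series_cvg _ k) => n; rewrite -le_ofR -HR -Mk.
  exact: le_trans (norm_im_le _) (H n).
exists ((limn (series (re \o u)) +i* limn (series (im \o u)))%C : C).
apply: cvg_ReIm.
- by rewrite (_ : (fun _ => _) = series (re \o u)) //; apply/funext => n; rewrite re_sum.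
- by rewrite (_ : (fun _ => _) = series (im \o u)) //; apply/funext => n; rewrite im_sum.
Qed.

End Cplx.

Section Analytic.
Variable R : realType.
Local Notation C := (Cplx R).

Lemma series_term_bound (u : nat -> C) (l : C) : series u @ \oo --> l ->
  exists2 M : C, 0 <= M & forall n, `|u n| <= M.
Proof.
move=> H; have : cvgn (series u) by apply/cvg_ex; exists l.
move/cvg_series_cvg_0 => H0.
have : cvgn u by apply/cvg_ex; exists 0.
move/cvg_seq_bounded/pinfty_ex_gt0 => [M M0 HM].
exists M; first exact: ltW.
by move=> n; exact: HM.
Qed.

(** The terms at |w - z| < r / 32 are small against those at r / 2: with
    y = r / 16, the bound |u_n| (r / 2)^n <= M gives |u_n| y^n <= M / 8^n, which
    absorbs the factors n^2 <= 4^n of the Taylor estimate and leaves a convergent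
    geometric series. *)
Lemma power_series_derivative (u : nat -> C) (z r : C) (f : C -> C) : 0 < r ->
  (forall w, `|w - z| < r -> series (fun n => u n * (w - z) ^+ n) @ \oo --> f w) ->
  exists g : C -> C, forall w, `|w - z| < r / 32 ->
    series (fun n => (n.+1%:R * u n.+1) * (w - z) ^+ n) @ \oo --> g w /\
    is_derive w 1 f (g w).
Proof.
move=> r0 H.
pose x := r / 2; pose y := r / 16.
have x0 : 0 < x by rewrite divr_gt0.
have y0 : 0 < y by rewrite divr_gt0.
have [M M0 HM] : exists2 M : C, 0 <= M & forall n, `|u n * x ^+ n| <= M.
  have xr : `|(x + z) - z| < r.
    by rewrite addrK gtr0_norm // ltr_pdivrMr // ltr_pMr // ltr1n.
  by have := H _ xr; rewrite addrK; exact: series_term_bound.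
have Hu n : `|u n| * y ^+ n <= M / 8 ^+ n.
  have -> : y = x / 8 by rewrite /y /x; field.
  rewrite expr_div_n mulrA ler_wpM2r ?invr_ge0 ?exprn_ge0 //.
  by have := HM n; rewrite normrM normrX (gtr0_norm x0).
have n2 n : (n%:R : C) <= 2 ^+ n by rewrite -natrX ler_nat ltnW // ltn_expl.
have small w : `|w - z| < r / 32 -> `|w - z| <= y.
  move=> /ltW h; apply: le_trans h _; rewrite ler_pdivrMr // mulrAC.
  by rewrite ler_pdivlMr // ler_pM2l // ler_nat.
move: y y0 small Hu => y y0 small Hu {x x0 HM}.
have y0' := ltW y0.
have cv w : `|w - z| < r / 32 ->
    exists l : C, series (fun n => (n.+1%:R * u n.+1) * (w - z) ^+ n) @ \oo --> l.
  move=> /small wy; apply: (@series_cvg_of_half _ _ (M / y)) => n.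
  rewrite !normrM normr_nat normrX.
  apply: (@le_trans _ _ (2 ^+ n.+1 * (`|u n.+1| * y ^+ n))).
    rewrite -mulrA ler_pM ?mulr_ge0 ?exprn_ge0 // ler_wpM2l //.
    by rewrite lerXn2r // nnegrE.
  have -> : 2 ^+ n.+1 * (`|u n.+1| * y ^+ n) =
     2 ^+ n.+1 / y * (`|u n.+1| * y ^+ n.+1).
    rewrite [y ^+ n.+1]exprS; field; exact: lt0r_neq0.
  apply: (@le_trans _ _ (2 ^+ n.+1 / y * (M / 8 ^+ n.+1))).
    by rewrite ler_wpM2l // divr_ge0 ?exprn_ge0 //.
  have -> : 2 ^+ n.+1 / y * (M / 8 ^+ n.+1) = M / y * (2 ^+ n.+1 / 8 ^+ n.+1).
    by move: (2 ^+ n.+1) (y^-1) (8 ^- n.+1) => a b c; ring.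
  rewrite ler_wpM2l ?divr_ge0 //.
  rewrite (_ : 8 = 2 * 4 :> C); last by rewrite -natrM.
  rewrite exprMn invfM mulrA divff ?expf_neq0 // mul1r lef_pV2 ?posrE ?exprn_gt0 //.
  by rewrite -!natrX ler_nat (_ : 4%N = (2 ^ 2)%N) // -expnM leq_exp2l // (leq_trans (leqnSn n)) // leq_pmull.
pose g w := xget 0 [set l : C | series (fun n => (n.+1%:R * u n.+1) * (w - z) ^+ n) @ \oo --> l].
exists g => w wr.
have gw : series (fun n => (n.+1%:R * u n.+1) * (w - z) ^+ n) @ \oo --> g w.
  have [l Hl] := cv w wr.
  by apply: (@xgetPex _ 0 [set l : C | series (fun n => (n.+1%:R * u n.+1) * (w - z) ^+ n) @ \oo --> l]); exists l.
split; first exact: gw.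
have r32 : 0 < r / 32 - `|w - z| by rewrite subr_gt0.
apply: (@is_derive_of_quadratic_bound _ _ _ _ (2 * (M / y ^+ 2)) _ r32).
  by rewrite mulr_ge0 // divr_ge0 ?exprn_ge0 //.
move=> h hr.
have whr : `|h + w - z| < r / 32.
  by rewrite -addrA; apply: le_lt_trans (ler_normD _ _) _; rewrite -ltrBrDr.
have r32r : r / 32 < r by rewrite ltr_pdivrMr // ltr_pMr // ltr1n.
have := H _ (lt_trans whr r32r); have := H _ (lt_trans wr r32r).
rewrite (_ : h + w - z = (w - z) + h); last by ring.
rewrite (_ : h + w - z = (w - z) + h) in whr; last by ring.
move=> cw cwh.
pose S N := series (fun n => u n * ((w - z) + h) ^+ n) N.+1
   - series (fun n => u n * (w - z) ^+ n) N.+1 - h * series (fun n => (n.+1%:R * u n.+1) * (w - z) ^+ n) N.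
have cS : S N @[N --> \oo] --> f (h + w) - f w - h * g w.
  apply: cvgB.
    by apply: cvgB; rewrite (cvg_shiftS (series _)); [exact: cwh|exact: cw].
  by apply: cvgM; [exact: cvg_cst|exact: gw].
have SE N : S N = \sum_(n < N.+1) u n * (((w - z) + h) ^+ n - (w - z) ^+ n - n%:R * h * (w - z) ^+ n.-1).
  rewrite /S /series /= !big_mkord.
  under [in RHS]eq_bigr do rewrite mulrBr mulrBr.
  rewrite !big_split /= !sumrN; congr (_ - _).
  rewrite big_ord_recl /= !mul0r mulr0 add0r mulr_sumr.
  by apply: eq_bigr => i _; rewrite /bump /=; ring.
have Sb N : `|S N| <= 2 * (M / y ^+ 2) * `|h| ^+ 2.
  rewrite SE; apply: le_trans (ler_norm_sum _ _ _) _.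
  apply: (@le_trans _ _ (\sum_(n < N.+1) M / y ^+ 2 * `|h| ^+ 2 * 2 ^- n)); last first.
    rewrite -mulr_sumr -[leRHS]mulrA [leRHS]mulrC ler_wpM2l ?geometric_half_sum //.
    by rewrite mulr_ge0 ?exprn_ge0 // divr_ge0 ?exprn_ge0 //.
  apply: ler_sum => n _; rewrite normrM.
  have Tb := @pow_taylor_bound _ (w - z) h y n (ltW y0) (small _ wr).
  have {}Tb : `|(w - z + h) ^+ n - (w - z) ^+ n - n%:R * h * (w - z) ^+ n.-1| <=
     (n ^ 2)%:R * `|h| ^+ 2 * y ^+ n / y ^+ 2.
    rewrite ler_pdivlMr ?exprn_gt0 // Tb //.
    move: (small (h + w)); rewrite (_ : h + w - z = (w - z) + h); last by ring.
    exact.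
  apply: le_trans (ler_wpM2l (normr_ge0 _) Tb) _.
  have -> : `|u n| * ((n ^ 2)%:R * `|h| ^+ 2 * y ^+ n / y ^+ 2) =
     (n ^ 2)%:R * (`|u n| * y ^+ n) * (`|h| ^+ 2 / y ^+ 2).
    by move: (y ^- 2) (y ^+ n) (`|h| ^+ 2) => a b c; ring.
  have -> : M / y ^+ 2 * `|h| ^+ 2 / 2 ^+ n = M / 2 ^+ n * (`|h| ^+ 2 / y ^+ 2).
    by move: (y ^- 2) (2 ^- n) (`|h| ^+ 2) => a b c; ring.
  rewrite ler_wpM2r ?divr_ge0 ?exprn_ge0 //.
  apply: le_trans (ler_wpM2l (ler0n _ _) (Hu n)) _.
  rewrite mulrCA ler_wpM2l //.
  rewrite (_ : 8 = 4 * 2 :> C); last by rewrite -natrM.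
  rewrite exprMn invfM mulrA -[leRHS]mul1r ler_wpM2r ?invr_ge0 ?exprn_ge0 //.
  rewrite ler_pdivrMr ?exprn_gt0 // mul1r -natrX ler_nat.
  by rewrite (_ : 4%N = (2 ^ 2)%N) // -expnM mulnC expnM leq_sqr ltnW // ltn_expl.
apply/ler_addgt0Pr => e e0.
have [N _ HN] : \forall N \near \oo, `|f (h + w) - f w - h * g w - S N| < e.
  by move/cvgrPdist_lt: cS; apply.
have := HN N (leqnn N) => /ltW HNN.
rewrite -[X in `|X|](subrK (S N)) addrC.
apply: le_trans (ler_normD _ _) _; exact: lerD.
Qed.

Lemma analytic_derivative (f : C -> C) (z : C) : analytic_at f z ->
  exists g : C -> C, analytic_at g z /\ \forall w \near z, is_derive (w : C) (1 : C) f (g w).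
Proof.
case=> u /nbhs_normP[r /= r0 Hr].
have [|g Hg] := @power_series_derivative u z r f r0.
  by move=> w wr; apply: Hr; rewrite /ball_ /= distrC.
have r32 : 0 < r / 32 by rewrite divr_gt0.
exists g; split.
  exists (fun n => n.+1%:R * u n.+1); apply/nbhs_normP; exists (r / 32); first exact: r32.
  move=> w; by rewrite /ball_ /= distrC => /Hg[].
apply/nbhs_normP; exists (r / 32); first exact: r32.
by move=> w; rewrite /ball_ /= distrC => /Hg[].
Qed.

End Analytic.

(** * Functions with zero derivative *)

Section ZeroDerivative.
Variable R : realType.
Local Notation C := (Cplx R).

(** The mean value theorem is real; it is applied to a real part L of f along
    the segment from z to z + d. *)
Lemma zero_derivative_part (L : C -> R) (f : C -> C) (z d : C) :
  (forall a b, L (a - b) = L a - L b) -> (forall a, ofR `|L a| <= `|a|) ->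
  (forall s : R, 0 <= s <= 1 -> is_derive (z + ofR s * d) (1 : C) f 0) ->
  L (f (z + d)) = L (f z).
Proof.
move=> LB Ln H.
pose phi (s : R) := L (f (z + ofR s * d)).
have ofRD (a b : R) : ofR (a + b) = ofR a + ofR b by exact: rmorphD.
have D (s : R) : 0 <= s <= 1 -> is_derive s (1 : R) phi 0.
  move=> s01; apply/is_derive_cvgP/cvgrPdist_le => e e0.
  have := H s s01; move/is_derive_cvgP.
  set x := z + ofR s * d => /cvgrPdist_le.
  have d1 : 0 < `|d| + 1 by rewrite ltr_wpDl.
  have e1 : 0 < ofR e / (`|d| + 1) by rewrite divr_gt0 // (lt_ofR 0).
  move/(_ _ e1)/nbhs_normP => [k /= /ofR_gt0[r r0 ->] Hk0].
  have Hk v : `|v| < ofR r -> v != 0 -> `|0 - v^-1 * (f (v + x) - f x)| <= ofR e / (`|d| + 1).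
    by move=> vr v0; apply: Hk0 => //; rewrite /ball_ /= sub0r normrN.
  have [q q0 Hq] : exists2 q : R, 0 < q & ofR q * (`|d| + 1) <= ofR r.
    have : 0 < ofR r / (`|d| + 1) by rewrite divr_gt0 // (lt_ofR 0).
    by case/ofR_gt0 => q q0 qe; exists q => //; rewrite -qe divfK // lt0r_neq0.
  near=> h.
  have h0 : h != 0 by near: h; exact: nbhs_dnbhs_neq.
  have hq : `|h| < q by near: h; exact: dnbhs0_lt.
  rewrite sub0r normrN normrM normfV ler_pdivrMl ?normr_gt0 //.
  rewrite /phi -LB -le_ofR; apply: le_trans (Ln _) _.
  rewrite ofRD mulrDl addrCA addrC -/x.
  have [d0|d0] := eqVneq d 0.
    by rewrite d0 mulr0 addr0 subrr normr0 (le_ofR 0) mulr_ge0 // ltW.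
  have hd0 : ofR h * d != 0.
    by rewrite mulf_neq0 // /ofR fmorph_eq0.
  have hdr : `|ofR h * d| < ofR r.
    apply: lt_le_trans Hq; rewrite normrM norm_ofR.
    apply: (@le_lt_trans _ _ (ofR q * `|d|)).
      by rewrite ler_wpM2r // le_ofR ltW.
    by rewrite ltr_pM2l ?ltrDl // (lt_ofR 0).
  have := Hk _ hdr hd0; rewrite sub0r normrN normrM normfV ler_pdivrMl ?normr_gt0 //.
  rewrite [_ + x]addrC => B; apply: le_trans B _.
  rewrite normrM norm_ofR (_ : ofR (`|h| * e) = ofR `|h| * ofR e); last exact: rmorphM.
  rewrite -mulrA ler_wpM2l ?(le_ofR 0) //.
  rewrite mulrCA -[leRHS]mulr1 ler_wpM2l ?(le_ofR 0) ?(ltW e0) //.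
  by rewrite ler_pdivrMr // mul1r lerDl.
have cont : {within `[0, 1], continuous phi}.
  apply: derivable_within_continuous => s; rewrite in_itv /= => s01.
  by have [] := D s s01.
have [|c _ E] := MVT_segment ler01 _ cont (df := fun=> 0).
  by move=> s; rewrite in_itv /= => /andP[a b]; apply: D; rewrite !ltW.
move: E; rewrite mul0r /phi => /eqP; rewrite subr_eq0 => /eqP.
by rewrite /ofR rmorph0 rmorph1 mul0r mul1r addr0.
Unshelve. all: by end_near. Qed.

Lemma zero_derivative_constant (f : C -> C) (z r w : C) :
  (forall v, `|v - z| < r -> is_derive (v : C) (1 : C) f 0) -> `|w - z| < r ->
  f w = f z.
Proof.
move=> H wr.
have G s : 0 <= s <= 1 -> is_derive (z + ofR s * (w - z)) (1 : C) f 0.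
  move=> /andP[s0 s1]; apply: H; rewrite addrC addKr normrM.
  apply: le_lt_trans wr; rewrite -[leRHS]mul1r ler_wpM2r //.
  rewrite ger0_norm ?(le_ofR 0) // -[1]/(ofR 1) ?le_ofR //.
have reB (x y : C) : complex.Re (x - y) = complex.Re x - complex.Re y by case: x y => [? ?] [? ?].
have imB (x y : C) : complex.Im (x - y) = complex.Im x - complex.Im y by case: x y => [? ?] [? ?].
have E1 := zero_derivative_part reB (@norm_re_le R) G.
have E2 := zero_derivative_part imB (@norm_im_le R) G.
rewrite addrC subrK in E1 E2.
by apply/eqP; rewrite eq_complex E1 E2 !eqxx.
Qed.

End ZeroDerivative.

(** * Recurrence of maps to second countable spaces *)

Section Recurrence.
Variable R : realType.
Local Notation C := (Cplx R).

Lemma unit_interval_uncountable : ~ countable [set` `]0, 1[ : interval R].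
Proof.
move=> /countable_lebesgue_measure0; rewrite lebesgue_measure_itv /= lte_fin ltr01.
by rewrite sube0 => /eqP; rewrite eqe oner_eq0.
Qed.

(** Otherwise every parameter of a real segment has a basic open set V around
    its image and an integer n such that no other parameter at distance less
    than 1 / (n + 1) is mapped to V.  The code of V, the integer n and the index
    of the interval of length 1 / (n + 1) that contains the parameter then
    determine the parameter, and the segment would be countable. *)
Lemma recurrent_parameter (S : topologicalType) (s : C -> S) (z r : C) :
  @second_countable S -> 0 < r ->
  exists2 t0 : C, `|t0 - z| < r &
    forall (N : set S) (e : C), nbhs (s t0) N -> 0 < e ->
    exists t : C, [/\ `|t - z| < r, t != t0, `|t - t0| < e & N (s t)].
Proof.
move=> [B cB [oB bB]] r0; apply: contrapT => H.
have r0' : r != 0 by exact: lt0r_neq0.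
pose p (x : R) := z + ofR x * r.
have ofRB (a b : R) : ofR (a - b) = ofR a - ofR b by exact: rmorphB.
have pB x y : p x - p y = ofR (x - y) * r by rewrite /p ofRB; ring.
have bad (x : R) : exists Vn : set S * nat, 0 < x < 1 ->
    [/\ B Vn.1, Vn.1 (s (p x)) & forall y, 0 < y < 1 -> y != x ->
       `|y - x| < Vn.2.+1%:R^-1 -> ~ Vn.1 (s (p y))].
  have [x01|] := boolP (0 < x < 1); last by exists (set0, 0%N).
  have inball (y : R) : 0 < y < 1 -> `|p y - z| < r.
    move=> /andP[y0 y1]; rewrite addrC addKr normrM norm_ofR (gtr0_norm r0) gtr0_norm //.
    by rewrite -[ltRHS]mul1r ltr_pM2r // -[1]/(ofR 1) lt_ofR.
  have [N [e [HN e0 Hx]]] : exists (N : set S) (e : C), [/\ nbhs (s (p x)) N, 0 < e &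
      forall t, `|t - z| < r -> t != p x -> `|t - p x| < e -> ~ N (s t)].
    apply: contrapT => H'; apply: H; exists (p x); first exact: inball.
    move=> N e HN e0; apply: contrapT => H''; apply: H'; exists N, e; split => // t t1 t2 t3 t4.
    by apply: H''; exists t.
  have [V [BV Vx] VN] := bB _ _ HN.
  have [e' e'0 ee] : exists2 e' : R, 0 < e' & ofR e' * r <= e.
    have : 0 < e / r by rewrite divr_gt0.
    by case/ofR_gt0 => q q0 qe; exists q => //; rewrite -qe divfK.
  have [n Hn] : exists n : nat, n.+1%:R^-1 < e'.
    have [n Hn] := ltr_add_invr (e'0); exists n; by rewrite add0r in Hn.
  exists (V, n) => _; split => //= y y01 yx yd Vy.
  apply: (Hx (p y)); first exact: inball.
  - rewrite -subr_eq0 pB mulf_neq0 // /ofR fmorph_eq0 subr_eq0 //.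
  - rewrite pB normrM norm_ofR (gtr0_norm r0); apply: lt_le_trans ee.
    by rewrite ltr_pM2r // lt_ofR (lt_trans yd).
  - exact: VN.
have [F HF] := choice bad.
have /countable_injP[g gI] := cB.
apply: unit_interval_uncountable; apply/countable_injP.
exists (fun x => pickle (g (F x).1, (F x).2, Num.floor (x * (F x).2.+1%:R))).
move=> x y; rewrite !inE /= !in_itv /= => x01 y01 /(pcan_inj (@pickleK _)) [E1 E2 E3].
have [Bx Vx Hx] := HF x x01; have [By Vy _] := HF y y01.
have EV : (F x).1 = (F y).1 by apply: gI; rewrite ?inE.
apply/eqP/negPn/negP => xy.
apply: (Hx y) => //; first by rewrite eq_sym.
  move: E3; rewrite -E2; set n := (F x).2 => E3.
  have n0 : 0 < (n.+1%:R : R) by [].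
  rewrite -[ltRHS]mul1r ltr_pdivlMr // -[X in _ * X]gtr0_norm // -normrM mulrBl.
  have := Num.Theory.floor_le (x * n.+1%:R); have := Num.Theory.floorD1_gt (x * n.+1%:R).
  have := Num.Theory.floor_le (y * n.+1%:R); have := Num.Theory.floorD1_gt (y * n.+1%:R).
  rewrite -E3 intrD; set a := _%:~R => h1 h2 h3 h4.
  by rewrite ltr_norml; apply/andP; split; lra.
by rewrite EV.
Qed.

End Recurrence.

(** * Tangent lines as limits of secants *)

Section Tangent.
Variable R : realType.
Local Notation C := (Cplx R).

Lemma mem_line_of (l : 'cV[C]_3) (v : 'rV[C]_3) :
  (v \in line_of l) = (\sum_j v 0 j * l j 0 == 0).
Proof.
rewrite /line_of memv_ker lfunE /=; apply/eqP/eqP => [/matrixP/(_ 0 0)|H].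
  by rewrite !mxE.
by apply/matrixP => i j; rewrite !ord1 !mxE.
Qed.

(** A vector that secants through s approximate arbitrarily well belongs to the
    tangent line, because the pairing of a vector with an equation of a line is
    continuous in both. *)
Lemma tangent_contains (a : analytic_curve R) (s : a) T (v : 'rV[C]_3) :
  tangent_line s T ->
  (forall (N : set a) (e : C), nbhs s N -> 0 < e -> exists q (v' : 'rV[C]_3),
     [/\ N q, q != s, v' \in line_through (curve_map s) (curve_map q)
       & forall j, `|v' 0 j - v 0 j| < e]) ->
  v \in T.
Proof.
move=> [l [l0 [l00 -> cl sec]]] H; rewrite mem_line_of.
apply/negPn/negP => nz.
pose c : C := `|\sum_j v 0 j * l0 j 0|.
have c0 : 0 < c by rewrite normr_gt0.
pose A : C := \sum_j (`|v 0 j| + (`|l0 j 0| + 1)).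
have A0 : 0 <= A by apply: sumr_ge0 => j _; rewrite !addr_ge0.
have A1 : 0 < A + 1 by rewrite ltr_wpDl.
pose e : C := c / (A + 1 + c).
have Ac0 : 0 < A + 1 + c by rewrite addr_gt0.
have e0 : 0 < e by rewrite divr_gt0.
have e1 : e <= 1 by rewrite ler_pdivrMr // mul1r lerDr ltW.
have eA : e <= c / (A + 1) by rewrite ler_wpM2l ?(ltW c0) // lef_pV2 ?posrE // lerDl ltW.
have near_l : \forall q \near s^', forall j, `|l q j 0 - l0 j 0| < e.
  have cj j : l q j 0 @[q --> s^'] --> l0 j 0.
    have H1 := @coord_continuous C 3 1 j 0 l0.
    have H2 := cvg_comp _ _ cl H1.
    exact: H2.
  apply: filter_forall => j; near=> q; rewrite distrC; near: q.
  by move/cvgrPdist_lt : (cj j); apply.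
have [q [v' [q12 qs v'L v'e]]] := H _ _ (filterI near_l sec) e0.
have [q1 q2] := q12 qs.
move: v'L; rewrite q2 mem_line_of => /eqP v'l.
have : c <= \sum_j e * (`|v 0 j| + (`|l0 j 0| + 1)).
  rewrite /c -normrN -[X in `|X|]add0r -[in X in `|X - _|]v'l -sumrB.
  apply: le_trans (ler_norm_sum _ _ _) _; apply: ler_sum => j _.
  have -> : v' 0 j * l q j 0 - v 0 j * l0 j 0 =
    v 0 j * (l q j 0 - l0 j 0) + (v' 0 j - v 0 j) * (l0 j 0 + (l q j 0 - l0 j 0)) by ring.
  apply: le_trans (ler_normD _ _) _; rewrite !normrM mulrDr lerD //.
    by rewrite mulrC ler_wpM2r // ltW.
  apply: ler_pM => //; first by rewrite ltW.
  apply: le_trans (ler_normD _ _) _; rewrite lerD2l.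
  exact: le_trans (ltW (q1 j)) e1.
rewrite -mulr_sumr -/A; apply/negP; rewrite lt_geF //.
apply: (@le_lt_trans _ _ (c / (A + 1) * A)); first by rewrite ler_wpM2r.
by rewrite mulrAC ltr_pdivrMr // ltr_pM2l // ltrDl.
Unshelve. all: by end_near. Qed.

End Tangent.

(** * Isotropic coordinates and symmetries *)

Section Reflection.
Variable R : realType.
Local Notation C := (Cplx R).
Implicit Types (x : 'rV[C]_2) (Y : 'rV[C]_3).

Definition zc x : C := x 0 0 + 'i * x 0 1.
Definition wc x : C := x 0 0 - 'i * x 0 1.
(** A point of the projective plane with coordinates Y has the isotropic
    coordinates hz Y / hs Y and hw Y / hs Y when it is affine. *)
Definition hz Y : C := zc (lsubmx (Y : 'M[C]_(1, 2 + 1))).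
Definition hw Y : C := wc (lsubmx (Y : 'M[C]_(1, 2 + 1))).
Definition hs Y : C := rsubmx (Y : 'M[C]_(1, 2 + 1)) 0 0.

Lemma zcL k x y : zc (k *: x + y) = k * zc x + zc y.
Proof. by rewrite /zc !mxE; ring. Qed.
Lemma wcL k x y : wc (k *: x + y) = k * wc x + wc y.
Proof. by rewrite /wc !mxE; ring. Qed.
Lemma hzL k Y Z : hz (k *: Y + Z) = k * hz Y + hz Z.
Proof. by rewrite /hz /zc !mxE; ring. Qed.
Lemma hwL k Y Z : hw (k *: Y + Z) = k * hw Y + hw Z.
Proof. by rewrite /hw /wc !mxE; ring. Qed.
Lemma hsL k Y Z : hs (k *: Y + Z) = k * hs Y + hs Z.
Proof. by rewrite /hs !mxE. Qed.
Lemma zcZ k x : zc (k *: x) = k * zc x.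
Proof. by rewrite /zc !mxE; ring. Qed.
Lemma wcZ k x : wc (k *: x) = k * wc x.
Proof. by rewrite /wc !mxE; ring. Qed.
Lemma hzZ k Y : hz (k *: Y) = k * hz Y.
Proof. by rewrite /hz /zc !mxE; ring. Qed.
Lemma hwZ k Y : hw (k *: Y) = k * hw Y.
Proof. by rewrite /hw /wc !mxE; ring. Qed.
Lemma hsZ k Y : hs (k *: Y) = k * hs Y.
Proof. by rewrite /hs !mxE. Qed.
Lemma hzD Y Z : hz (Y + Z) = hz Y + hz Z.
Proof. by rewrite -[Y]scale1r hzL hzZ. Qed.
Lemma hwD Y Z : hw (Y + Z) = hw Y + hw Z.
Proof. by rewrite -[Y]scale1r hwL hwZ. Qed.
Lemma hsD Y Z : hs (Y + Z) = hs Y + hs Z.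
Proof. by rewrite -[Y]scale1r hsL hsZ. Qed.
Lemma zc0 : zc 0 = 0. Proof. by rewrite /zc !mxE mulr0 addr0. Qed.
Lemma wc0 : wc 0 = 0. Proof. by rewrite /wc !mxE mulr0 subr0. Qed.

Lemma isotropic_coord_inj x y : zc x = zc y -> wc x = wc y -> x = y.
Proof.
move=> hzz hww.
have e0 : x 0 0 = y 0 0.
  apply: (@mulfI _ (2 : C)); first by rewrite pnatr_eq0.
  have -> : 2 * x 0 0 = zc x + wc x by rewrite /zc /wc; ring.
  by rewrite hzz hww /zc /wc; ring.
have e1 : x 0 1 = y 0 1.
  apply: (@mulfI _ (2 * 'i : C)); first by rewrite mulf_neq0 ?pnatr_eq0 ?neq0Ci.
  have -> : 2 * 'i * x 0 1 = zc x - wc x by rewrite /zc /wc; ring.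
  by rewrite hzz hww /zc /wc; ring.
by apply/rowP; case=> [[|[|//]]] h; [move: e0|move: e1]; congr (x _ _ = y _ _); apply/val_inj.
Qed.

Lemma quad_formE x : quad_form x = zc x * wc x.
Proof.
have := sqrCi C; rewrite /quad_form /zc /wc => e.
by transitivity (x 0 0 ^+ 2 - 'i ^+ 2 * x 0 1 ^+ 2); [rewrite e; ring|ring].
Qed.

Lemma homogeneous_inj Y Z : hz Y = hz Z -> hw Y = hw Z -> hs Y = hs Z -> Y = Z.
Proof.
move=> hzz hww hss.
have eL := isotropic_coord_inj hzz hww.
have eR : rsubmx (Y : 'M[C]_(1, 2 + 1)) = rsubmx (Z : 'M[C]_(1, 2 + 1)).
  by apply/rowP => j; rewrite ord1.
by rewrite -[Y](@hsubmxK _ 1 2 1) eL eR hsubmxK.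
Qed.

Lemma hz_row x (k : 'M[C]_1) : hz (row_mx x k) = zc x.
Proof. by rewrite /hz row_mxKl. Qed.
Lemma hw_row x (k : 'M[C]_1) : hw (row_mx x k) = wc x.
Proof. by rewrite /hw row_mxKl. Qed.
Lemma hs_row x (k : 'M[C]_1) : hs (row_mx x k) = k 0 0.
Proof. by rewrite /hs row_mxKr. Qed.

Lemma hz_aff x : hz (affine_pt x) = zc x. Proof. exact: hz_row. Qed.
Lemma hw_aff x : hw (affine_pt x) = wc x. Proof. exact: hw_row. Qed.
Lemma hs_aff x : hs (affine_pt x) = 1. Proof. by rewrite hs_row mxE. Qed.
Lemma hz_inf x : hz (infinite_pt x) = zc x. Proof. exact: hz_row. Qed.
Lemma hw_inf x : hw (infinite_pt x) = wc x. Proof. exact: hw_row. Qed.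
Lemma hs_inf x : hs (infinite_pt x) = 0. Proof. by rewrite hs_row mxE. Qed.

Definition ez : 'rV[C]_2 := \row_(j < 2) (if j == 0 then 2^-1 else (2 * 'i)^-1).
Definition ew : 'rV[C]_2 := \row_(j < 2) (if j == 0 then 2^-1 else - (2 * 'i)^-1).

Lemma zc_ez : zc ez = 1.
Proof. by rewrite /zc /ez !mxE /=; field; rewrite ?pnatr_eq0 ?neq0Ci. Qed.
Lemma wc_ez : wc ez = 0.
Proof. by rewrite /wc /ez !mxE /=; field; rewrite ?pnatr_eq0 ?neq0Ci. Qed.
Lemma zc_ew : zc ew = 0.
Proof. by rewrite /zc /ew !mxE /=; field; rewrite ?pnatr_eq0 ?neq0Ci. Qed.
Lemma wc_ew : wc ew = 1.
Proof. by rewrite /wc /ew !mxE /=; field; rewrite ?pnatr_eq0 ?neq0Ci. Qed.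

Lemma isotropic_basis x : x = zc x *: ez + wc x *: ew.
Proof.
apply: isotropic_coord_inj.
  by rewrite zcL -[_ *: ew]addr0 zcL zc_ez zc_ew zc0; ring.
by rewrite wcL -[_ *: ew]addr0 wcL wc_ez wc_ew wc0; ring.
Qed.

Lemma I1_coord : I1 R = row_mx (2 *: ew) 0.
Proof.
rewrite /I1 /infinite_pt (_ : (\row_j _) = 2 *: ew) //.
apply: isotropic_coord_inj; rewrite -[_ *: ew]addr0.
  by rewrite zcL zc_ew zc0 /zc !mxE /= -expr2 sqrCi; ring.
by rewrite wcL wc_ew wc0 /wc !mxE /= -expr2 sqrCi; ring.
Qed.

Lemma I2_coord : I2 R = row_mx (2 *: ez) 0.
Proof.
rewrite /I2 /infinite_pt (_ : (\row_j _) = 2 *: ez) //.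
apply: isotropic_coord_inj; rewrite -[_ *: ez]addr0.
  by rewrite zcL zc_ez zc0 /zc !mxE /= mulrN -expr2 sqrCi; ring.
by rewrite wcL wc_ez wc0 /wc !mxE /= mulrN -expr2 sqrCi; ring.
Qed.

(** A direction with a zero isotropic coordinate is proportional to I1 or I2. *)
Lemma nonisotropic_direction (L : {vspace 'rV[C]_3}) x :
  ~ isotropic L -> infinite_pt x \in L -> x != 0 -> zc x != 0 /\ wc x != 0.
Proof.
move=> nL xL x0.
have inf (k : C) (y : 'rV[C]_2) : k *: infinite_pt y = infinite_pt (k *: y).
  by apply: homogeneous_inj; rewrite ?hzZ ?hwZ ?hsZ !(hz_inf, hw_inf, hs_inf) ?zcZ ?wcZ ?mulr0.
have ex := isotropic_basis x.
split; apply/eqP => e; apply: nL.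
  left; have w0 : wc x != 0.
    by apply: contra x0 => /eqP w; rewrite ex e w !scale0r addr0.
  have -> : I1 R = (2 / wc x) *: infinite_pt x.
    by rewrite inf I1_coord -/(infinite_pt _) {2}ex e scale0r add0r scalerA divfK.
  exact: memvZ.
right; have w0 : zc x != 0.
  by apply: contra x0 => /eqP w; rewrite ex e w !scale0r addr0.
have -> : I2 R = (2 / zc x) *: infinite_pt x.
  by rewrite inf I2_coord -/(infinite_pt _) {2}ex e scale0r addr0 scalerA divfK.
exact: memvZ.
Qed.

(** The linear part M of the symmetry preserves the product of the isotropic
    coordinates, so it either rescales or exchanges the two isotropic
    directions.  Fixing ta, it is the identity in the first case, which is
    excluded; in the second it sends (z, w) to (m w, z / m), where m is the
    slope of ta. *)
Lemma symmetry_action (L : {vspace 'rV[C]_3}) P (al ta : 'rV[C]_2) Y :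
  is_symmetry L P -> affine_pt al \in L -> infinite_pt ta \in L ->
  zc ta != 0 -> wc ta != 0 ->
  [/\ hs (Y *m P) = hs Y,
      (hz (Y *m P) - hs Y * zc al) * wc ta = zc ta * (hw Y - hs Y * wc al) &
      (hw (Y *m P) - hs Y * wc al) * zc ta = wc ta * (hz Y - hs Y * zc al)].
Proof.
move=> [[M [v [-> qM]]] _ P1 fixL] aL tL z0 w0.
have act (x : 'rV[C]_2) (k : 'M[C]_1) : row_mx x k *m affine_mx M v = row_mx (x *m M + k *m v) k.
  have := @mul_row_block C 1 2 1 2 1 x k M 0 v 1%:M.
  by rewrite mulmx0 add0r mulmx1.
have Mal : al *m M + v = al.
  have := fixL _ aL; rewrite /affine_pt act mul1mx.
  by case/(@eq_row_mx C 1 2 1) => ->.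
have Mta : ta *m M = ta.
  have : affine_pt (al + ta) \in L.
    rewrite (_ : affine_pt _ = affine_pt al + infinite_pt ta) ?memvD //.
    by apply: homogeneous_inj; rewrite ?hzD ?hwD ?hsD !(hz_inf, hw_inf, hs_inf, hz_aff, hw_aff, hs_aff) ?addr0 // /zc /wc !mxE; ring.
  move/fixL; rewrite /affine_pt act mul1mx => /(@eq_row_mx C 1 2 1)[+ _].
  by rewrite mulmxDl addrAC Mal => /addrI.
have [a ea] : exists a, zc (ez *m M) = a by exists (zc (ez *m M)).
have [b eb] : exists b, zc (ew *m M) = b by exists (zc (ew *m M)).
have [c ec] : exists c, wc (ez *m M) = c by exists (wc (ez *m M)).
have [d ed] : exists d, wc (ew *m M) = d by exists (wc (ew *m M)).
have zM x : zc (x *m M) = a * zc x + b * wc x.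
  rewrite {1}[x]isotropic_basis mulmxDl -!scalemxAl zcL.
  by rewrite zcZ ea eb; ring.
have wM x : wc (x *m M) = c * zc x + d * wc x.
  rewrite {1}[x]isotropic_basis mulmxDl -!scalemxAl wcL.
  by rewrite wcZ ec ed; ring.
have ac : a * c = 0 by rewrite -ea -ec -quad_formE qM quad_formE wc_ez mulr0.
have bd : b * d = 0 by rewrite -eb -ed -quad_formE qM quad_formE zc_ew mul0r.
have abcd : a * d + b * c = 1.
  have := qM (1 *: ez + ew); rewrite !quad_formE zM wM !zcL !wcL zc_ez wc_ez zc_ew wc_ew => e.
  transitivity ((a * (1 * 1 + 0) + b * (1 * 0 + 1)) * (c * (1 * 1 + 0) + d * (1 * 0 + 1)) - a * c - b * d).
    by ring.
  by rewrite e ac bd; ring.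
have tz : a * zc ta + b * wc ta = zc ta by rewrite -zM Mta.
have tw : c * zc ta + d * wc ta = wc ta by rewrite -wM Mta.
(* a, b, c, d are the entries of M in the isotropic basis. *)
have [a0|a0] := eqVneq a 0; last first.
  have c0 : c = 0 by apply/eqP; move/eqP: ac; rewrite mulf_eq0 (negPf a0).
  have d0 : d != 0.
    by apply/eqP => d0; move/eqP: abcd; rewrite d0 c0 !mulr0 addr0 eq_sym oner_eq0.
  have b0 : b = 0 by apply/eqP; move/eqP: bd; rewrite mulf_eq0 (negPf d0) orbF.
  have a1 : a = 1.
    by apply: (mulIf z0); rewrite mul1r -[RHS]tz b0 mul0r addr0.
  have d1 : d = 1.
    by apply: (mulIf w0); rewrite mul1r -[RHS]tw c0 mul0r add0r.
  have M1 : M = 1%:M.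
    apply/row_matrixP => i; rewrite !rowE mulmx1.
    by apply: isotropic_coord_inj; rewrite ?zM ?wM ?a1 ?b0 ?c0 ?d1; ring.
  have v0 : v = 0 by move: Mal; rewrite M1 mulmx1 -{2}[al]addr0 => /addrI.
  by case: P1; rewrite M1 v0 /affine_mx -scalar_mx_block.
have d0 : d = 0.
  have : b != 0.
    by apply/eqP => b0; move/eqP: abcd; rewrite a0 b0 !mul0r addr0 eq_sym oner_eq0.
  by move=> b0; apply/eqP; move/eqP: bd; rewrite mulf_eq0 (negPf b0).
have eb' : b * wc ta = zc ta by rewrite -[RHS]tz a0 mul0r add0r.
have ec' : c * zc ta = wc ta by rewrite -[RHS]tw d0 mul0r addr0.
rewrite -[Y](@hsubmxK _ 1 2 1) act; move: (lsubmx _) (rsubmx _) => x k.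
have vE : v = -1 *: (al *m M) + al by rewrite -{2}Mal scaleN1r addKr.
have kE : k *m v = k 0 0 *: v.
  by rewrite [k]mx11_scalar mul_scalar_mx mxE eqxx mulr1n.
rewrite !hs_row !hz_row !hw_row kE [x *m M + _]addrC.
split=> //; rewrite ?(zcL, wcL) vE ?(zcL, wcL) ?zM ?wM ?a0 ?d0.
  by rewrite -eb'; ring.
by rewrite -ec'; ring.
Qed.

End Reflection.

Section ReflectionLaw.
Variable R : realType.
Local Notation C := (Cplx R).

Lemma line_throughC (p q : CP2 R) : line_through p q = line_through q p.
Proof. exact: addvC. Qed.

Lemma symmetric_linesC (T l l' : {vspace 'rV[C]_3}) :
  symmetric_lines T l l' -> symmetric_lines T l' l.
Proof.
case=> P sP <-; exists P => //; have [_ PP _ _] := sP.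
apply/vspaceP => v; apply/idP/idP.
  case/memv_imgP => u /memv_imgP[w wl ->] ->.
  by rewrite !lfunE /= -mulmxA PP mulmx1.
move=> vl; apply/memv_imgP; exists (v *m P).
  by apply/memv_imgP; exists v => //; rewrite lfunE.
by rewrite lfunE /= -mulmxA PP mulmx1.
Qed.

(** The slopes of the two lines have product the square of the slope of T.
    Clearing denominators, the law also covers a point of coordinates Y on the
    infinity line. *)
Lemma reflection_law (T : {vspace 'rV[C]_3}) (p q q' : CP2 R) (al be ta : 'rV[C]_2) Y :
  symmetric_lines T (line_through p q) (line_through p q') ->
  val p = <[affine_pt al]>%VS -> val q = <[affine_pt be]>%VS -> val q' = <[Y]>%VS ->
  affine_pt al \in T -> infinite_pt ta \in T -> zc ta != 0 -> wc ta != 0 ->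
  (hz Y - hs Y * zc al) * (zc be - zc al) * wc ta ^+ 2 =
  zc ta ^+ 2 * ((hw Y - hs Y * wc al) * (wc be - wc al)).
Proof.
case=> P sP img ep eq eq' aT tT z0 w0.
have : Y \in line_through p q'.
  by rewrite /line_through eq'; apply: (subvP (addvSr _ _)); exact: memv_line.
rewrite -img => /memv_imgP[u]; rewrite /line_through ep eq.
case/memv_addP => _ /vlineP[k ->] [_ /vlineP[m ->] ->].
rewrite lfunE /= => ->.
have [-> -> ->] : [/\ hs ((k *: affine_pt al + m *: affine_pt be) *m P) = k + m,
   hz ((k *: affine_pt al + m *: affine_pt be) *m P) =
     (k + m) * zc al + m * (zc ta / wc ta * (wc be - wc al))
  & hw ((k *: affine_pt al + m *: affine_pt be) *m P) =
     (k + m) * wc al + m * (wc ta / zc ta * (zc be - zc al))].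
  have [e1 e2 e3] := symmetry_action (k *: affine_pt al + m *: affine_pt be) sP aT tT z0 w0.
  have es : hs (k *: affine_pt al + m *: affine_pt be) = k + m.
    by rewrite hsL hsZ !hs_aff !mulr1.
  have ez : hz (k *: affine_pt al + m *: affine_pt be) = k * zc al + m * zc be.
    by rewrite hzL hzZ !hz_aff.
  have ew : hw (k *: affine_pt al + m *: affine_pt be) = k * wc al + m * wc be.
    by rewrite hwL hwZ !hw_aff.
  rewrite es ez ew in e1 e2 e3; split=> //.
    apply/eqP; rewrite -subr_eq0; apply/eqP; apply: (mulIf w0); rewrite mul0r.
    move: e2; set H := hz _ => e2.
    have -> : (H - ((k + m) * zc al + m * (zc ta / wc ta * (wc be - wc al)))) * wc ta =
      (H - (k + m) * zc al) * wc ta - m * zc ta * (wc be - wc al) by field.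
    by rewrite e2; ring.
  apply/eqP; rewrite -subr_eq0; apply/eqP; apply: (mulIf z0); rewrite mul0r.
  move: e3; set H := hw _ => e3.
  have -> : (H - ((k + m) * wc al + m * (wc ta / zc ta * (zc be - zc al)))) * zc ta =
    (H - (k + m) * wc al) * zc ta - m * wc ta * (zc be - zc al) by field.
  by rewrite e3; ring.
by field; rewrite z0 w0.
Qed.

End ReflectionLaw.

(** * Functions with several continuous derivatives *)

Section Smooth.
Variable K : numFieldType.

Fixpoint smooth (k : nat) (D : set K) (f : K -> K) : Prop :=
  if k is k'.+1 then
    exists2 g : K -> K, (forall t, D t -> is_derive (t : K) (1 : K) f (g t)) & smooth k' D g
  else forall t, D t -> {for t, continuous f}.

Lemma smooth_sub k (D E : set K) f : E `<=` D -> smooth k D f -> smooth k E f.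
Proof.
move=> ED; elim: k f => [|k IH] f /=; first by move=> H t /ED; exact: H.
by move=> [g Hg sg]; exists g; [move=> t /ED; exact: Hg | exact: IH].
Qed.

Lemma smooth_continuous k (D : set K) f : smooth k D f -> forall t, D t -> {for t, continuous f}.
Proof.
by case: k => [//|k] [g Hg _] t /Hg; exact: is_derive_continuous.
Qed.

Lemma smoothW k (D : set K) f : smooth k.+1 D f -> smooth k D f.
Proof.
elim: k f => [|k IH] f; first by move=> sf t; exact: smooth_continuous sf t.
by move=> [g Hg sg]; exists g => //; exact: IH.
Qed.

Lemma smooth_cst k (D : set K) (c : K) : smooth k D (fun=> c).
Proof.
elim: k c => [|k IH] c /=; first by move=> t _; exact: cst_continuous.
by exists (fun=> 0) => [t _|]; [exact: is_derive_cst | exact: IH].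
Qed.

Lemma smoothD k (D : set K) f g : smooth k D f -> smooth k D g -> smooth k D (fun t => f t + g t).
Proof.
elim: k f g => [|k IH] f g /=.
  by move=> sf sg t Dt; apply: continuousD; [exact: sf|exact: sg].
move=> [f' Hf sf] [g' Hg sg]; exists (fun t => f' t + g' t); last exact: IH.
by move=> t Dt; apply: is_deriveD; [exact: Hf|exact: Hg].
Qed.

Lemma smoothM k (D : set K) f g : smooth k D f -> smooth k D g -> smooth k D (fun t => f t * g t).
Proof.
elim: k f g => [|k IH] f g.
  by move=> sf sg t Dt; apply: continuousM; [exact: sf|exact: sg].
move=> sf sg; have sf0 := smoothW sf; have sg0 := smoothW sg.
case: sf => f' Hf sf; case: sg => g' Hg sg.
exists (fun t => f t * g' t + g t * f' t); last by apply: smoothD; exact: IH.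
by move=> t Dt; apply: is_deriveM; [exact: Hf|exact: Hg].
Qed.

Lemma smoothV k (D : set K) f : (forall t, D t -> f t != 0) -> smooth k D f ->
  smooth k D (fun t => (f t)^-1).
Proof.
move=> f0; elim: k f f0 => [|k IH] f f0.
  by move=> sf t Dt; apply: continuousV; [exact: f0|exact: sf].
move=> sf; have sf0 := smoothW sf; case: sf => f' Hf sf.
exists (fun t => (-1 * ((f t)^-1 * (f t)^-1)) * f' t).
  move=> t Dt; apply: is_derive_eq.
    by apply: is_derive_invf; [exact: f0|exact: Hf].
  by rewrite expr2 invfM mulN1r.
by apply: smoothM => //; apply: smoothM; [exact: smooth_cst | apply: smoothM; exact: IH].
Qed.
End Smooth.

(** The domain depends on k: each differentiation of the power series shrinks
    the disc. *)
Lemma smooth_analytic (R : realType) k (f : Cplx R -> Cplx R) z : analytic_at f z ->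
  exists2 D : set (Cplx R), nbhs z D & smooth k D f.
Proof.
elim: k f => [|k IH] f /analytic_derivative[g [ag dg]].
  exists (fun w => is_derive (w : Cplx R) (1 : Cplx R) f (g w)) => // t.
  exact: is_derive_continuous.
have [D zD sD] := IH g ag.
exists (D `&` (fun w => is_derive (w : Cplx R) (1 : Cplx R) f (g w))); first exact: filterI.
exists g; first by move=> t [].
by apply: smooth_sub sD => t [].
Qed.

(** * Tangent lines and velocities *)

Section TangentLimits.
Variable R : realType.
Local Notation C := (Cplx R).

Definition iso_pt (z w : C) : 'rV[C]_2 := z *: ez R + w *: ew R.

Lemma hz0 : hz (0 : 'rV[C]_3) = 0.
Proof. by rewrite -(scale0r (0 : 'rV[C]_3)) hzZ mul0r. Qed.
Lemma hw0 : hw (0 : 'rV[C]_3) = 0.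
Proof. by rewrite -(scale0r (0 : 'rV[C]_3)) hwZ mul0r. Qed.
Lemma hs0 : hs (0 : 'rV[C]_3) = 0.
Proof. by rewrite -(scale0r (0 : 'rV[C]_3)) hsZ mul0r. Qed.

Lemma zc_iso_pt z w : zc (iso_pt z w) = z.
Proof. by rewrite /iso_pt zcL zcZ zc_ez zc_ew; ring. Qed.
Lemma wc_iso_pt z w : wc (iso_pt z w) = w.
Proof. by rewrite /iso_pt wcL wcZ wc_ez wc_ew; ring. Qed.
Lemma entry_bound (Y : 'rV[C]_3) j : `|Y 0 j| <= `|hz Y| + `|hw Y| + `|hs Y|.
Proof.
have E0 (x : 'rV[C]_2) (k : 'M[C]_1) i :
    `|row_mx x k 0 i| <= `|zc x| + `|wc x| + `|k 0 0|.
  have n2 : `|2 : C| = 2 by rewrite normr_nat.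
  have le2 (a : C) : `|a / 2| <= `|a|.
    by rewrite normrM normfV n2 ler_pdivrMr // ler_peMr // ler1n.
  have e0 : x 0 0 = (zc x + wc x) / 2.
    by rewrite /zc /wc; field.
  have e1 : x 0 1 = (zc x - wc x) / 2 / 'i.
    by rewrite /zc /wc; field; rewrite neq0Ci.
  have b0 : `|x 0 0| <= `|zc x| + `|wc x|.
    by rewrite e0; apply: le_trans (le2 _) _; exact: ler_normD.
  have b1 : `|x 0 1| <= `|zc x| + `|wc x|.
    rewrite e1 normrM normfV normCi invr1 mulr1; apply: le_trans (le2 _) _.
    exact: ler_normB.
  rewrite mxE; case: splitP => i' _.
    apply: (@le_trans _ _ (`|zc x| + `|wc x|)); last by rewrite lerDl.
    by case: i' => [[|[|//]]] h; [move: b0|move: b1]; congr (`|x _ _| <= _); exact/val_inj.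
  by rewrite (ord1 i') lerDr addr_ge0.
by have := E0 (lsubmx (Y : 'M[C]_(1, 2 + 1))) (rsubmx (Y : 'M[C]_(1, 2 + 1))) j; rewrite hsubmxK.
Qed.

(** All the secants through s contain s, and there are some arbitrarily close to
    s because the curve is not locally constant. *)
Lemma tangent_point (a : analytic_curve R) (s : a) T v :
  tangent_line s T -> v \in val (curve_map s) -> v \in T.
Proof.
move=> tT vs; apply: (tangent_contains tT) => N e sN e0.
have [q [Nq qs]] : exists q, N q /\ curve_map q <> curve_map s.
  apply: contrapT => H; apply: (@curve_nonconstant _ _ s).
  apply: filterS sN => q Nq; apply: contrapT => qs; apply: H; by exists q.
exists q, v; split => //.
- by apply/eqP => E; apply: qs; rewrite E.
- exact: (subvP (addvSl _ _)).
- by move=> j; rewrite subrr normr0.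
Qed.

(** This replaces continuity for the branch of the third mirror, on which an
    orbit is only known to exist: it is enough to form secants, and an arbitrary
    map has it somewhere by [recurrent_parameter]. *)
Definition recurrent_at (S : topologicalType) (D : set C) (s : C -> S) (t0 : C) :=
  forall (N : set S) (e : C), nbhs (s t0) N -> 0 < e ->
  exists t : C, [/\ D t, t != t0, `|t - t0| < e & N (s t)].

Lemma common_radius (k1 k2 : C) : 0 < k1 -> 0 < k2 ->
  exists2 k : C, 0 < k & k <= k1 /\ k <= k2.
Proof.
move=> h1 h2; have h12 : 0 < k1 + k2 by rewrite addr_gt0.
exists (k1 * k2 / (k1 + k2)); first by rewrite divr_gt0 ?mulr_gt0.
split; rewrite ler_pdivrMr //.
  by rewrite ler_pM2l // lerDr ltW.
by rewrite mulrC ler_pM2l // lerDl ltW.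
Qed.

Lemma is_derive_quotient_near (f : C -> C) (x d e : C) : is_derive x (1 : C) f d -> 0 < e ->
  exists2 k : C, 0 < k & forall t, t != x -> `|t - x| < k ->
    `|(t - x)^-1 * (f t - f x) - d| < e.
Proof.
move/is_derive_cvgP/cvgrPdist_lt => H e0.
have /nbhs_normP[k /= k0 Hk] := H e e0.
exists k => // t tx tk; rewrite distrC.
have := Hk (t - x); rewrite subrK; apply; last by rewrite subr_eq0.
by rewrite /ball_ /= sub0r normrN.
Qed.

(** The velocity is the limit of the directions of the secants given by the
    recurrence.  If it is non-zero, the point has moved and these secants are
    indeed lines through two distinct points. *)
Lemma tangent_derivative (a : analytic_curve R) (D : set C) (s : C -> a) t0 z w dz dw T :
  recurrent_at D s t0 -> D t0 ->
  (forall t, D t -> val (curve_map (s t)) = <[affine_pt (iso_pt (z t) (w t))]>%VS) ->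
  is_derive (t0 : C) (1 : C) z dz -> is_derive (t0 : C) (1 : C) w dw ->
  tangent_line (s t0) T -> infinite_pt (iso_pt dz dw) \in T.
Proof.
move=> rec D0 cs dz' dw' tT.
have [z0|nz] := boolP ((dz == 0) && (dw == 0)).
  case/andP: z0 => /eqP -> /eqP ->.
  rewrite (_ : infinite_pt _ = 0) ?mem0v //; apply: homogeneous_inj.
  - by rewrite hz_inf zc_iso_pt hz0.
  - by rewrite hw_inf wc_iso_pt hw0.
  - by rewrite hs_inf hs0.
apply: (tangent_contains tT) => N e sN e0.
pose c : C := `|dz| + `|dw|.
have c0 : 0 < c.
  move: nz; rewrite negb_and => /orP[] h.
    by rewrite ltr_pwDl ?normr_gt0.
  by rewrite ltr_wpDl ?normr_gt0.
have [k1 k10 Hz] := is_derive_quotient_near dz' (divr_gt0 e0 (ltr0n C 2)).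
have [k2 k20 Hw] := is_derive_quotient_near dw' (divr_gt0 e0 (ltr0n C 2)).
have [k3 k30 Hz'] := is_derive_quotient_near dz' (divr_gt0 c0 (ltr0n C 2)).
have [k4 k40 Hw'] := is_derive_quotient_near dw' (divr_gt0 c0 (ltr0n C 2)).
have [k5 k50 [k51 k52]] := common_radius k10 k20.
have [k6 k60 [k63 k64]] := common_radius k30 k40.
have [k k0 [k5k k6k]] := common_radius k50 k60.
have [t [Dt tt0 tk Nt]] := rec N k sN k0.
have le1 := lt_le_trans tk (le_trans k5k k51).
have le2 := lt_le_trans tk (le_trans k5k k52).
have le3 := lt_le_trans tk (le_trans k6k k63).
have le4 := lt_le_trans tk (le_trans k6k k64).
have {}Hz := Hz t tt0 le1; have {}Hw := Hw t tt0 le2.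
have {}Hz' := Hz' t tt0 le3; have {}Hw' := Hw' t tt0 le4.
exists (s t), ((t - t0)^-1 *: (affine_pt (iso_pt (z t) (w t)) - affine_pt (iso_pt (z t0) (w t0)))).
have h0 : t - t0 != 0 by rewrite subr_eq0.
split=> //.
- apply/eqP => E.
  have : affine_pt (iso_pt (z t) (w t)) \in <[affine_pt (iso_pt (z t0) (w t0))]>%VS.
    by rewrite -(cs t0 D0) -E (cs t Dt) memv_line.
  case/vlineP => l El.
  have l1 : l = 1 by have := congr1 (@hs R) El; rewrite hsZ !hs_aff mulr1.
  have ez : z t = z t0 by have := congr1 (@hz R) El; rewrite hzZ !hz_aff !zc_iso_pt l1 mul1r.
  have ew : w t = w t0 by have := congr1 (@hw R) El; rewrite hwZ !hw_aff !wc_iso_pt l1 mul1r.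
  move: Hz' Hw'; rewrite ez ew !subrr mulr0 !sub0r !normrN => A B.
  by have := ltrD A B; rewrite -splitr ltxx.
- apply: memvZ; apply: memvB; rewrite /line_through.
    by apply: (subvP (addvSr _ _)); rewrite (cs t Dt) memv_line.
  by apply: (subvP (addvSl _ _)); rewrite (cs t0 D0) memv_line.
move=> j; set Y := _ *: _; have -> : Y 0 j - infinite_pt (iso_pt dz dw) 0 j =
   (-1 *: infinite_pt (iso_pt dz dw) + Y) 0 j by rewrite !mxE; ring.
apply: le_lt_trans (entry_bound _ _) _.
have subE (A B : 'rV[C]_3) : A - B = -1 *: B + A by rewrite scaleN1r addrC.
have -> : hz (-1 *: infinite_pt (iso_pt dz dw) + Y) = (t - t0)^-1 * (z t - z t0) - dz.
  by rewrite hzL hz_inf /Y hzZ subE hzL !hz_aff !zc_iso_pt; ring.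
have -> : hw (-1 *: infinite_pt (iso_pt dz dw) + Y) = (t - t0)^-1 * (w t - w t0) - dw.
  by rewrite hwL hw_inf /Y hwZ subE hwL !hw_aff !wc_iso_pt; ring.
have -> : hs (-1 *: infinite_pt (iso_pt dz dw) + Y) = 0.
  by rewrite hsL hs_inf /Y hsZ subE hsL !hs_aff; ring.
by rewrite normr0 addr0 [ltRHS]splitr; exact: ltrD.
Qed.

Lemma proportional_line (u v : 'rV[C]_3) : u != 0 -> v != 0 -> hs u = 0 -> hs v = 0 ->
  hz u * hw v = hw u * hz v -> <[u]>%VS = <[v]>%VS.
Proof.
move=> u0 v0 su sv E.
suff [k Ek] : exists k, v = k *: u.
  have k0 : k != 0 by apply: contra v0 => /eqP k0; rewrite Ek k0 scale0r.
  apply/eqP; rewrite eqEsubv -!memvE Ek memvZ ?memv_line // andbT.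
  by apply/vlineP; exists k^-1; rewrite scalerK.
have [a0|a0] := eqVneq (hz u) 0; last first.
  exists (hz v / hz u); apply: homogeneous_inj; rewrite ?hzZ ?hwZ ?hsZ ?su ?sv ?mulr0 //.
    by rewrite divfK.
  by apply: (mulfI a0); rewrite E; field.
have b0 : hw u != 0.
  apply: contra u0 => /eqP b0; apply/eqP/homogeneous_inj; rewrite ?a0 ?b0 ?su ?hz0 ?hw0 ?hs0 //.
exists (hw v / hw u); apply: homogeneous_inj; rewrite ?hzZ ?hwZ ?hsZ ?su ?sv ?mulr0 //.
  by rewrite a0 mulr0; apply: (mulfI b0); rewrite -E a0 mul0r mulr0.
by rewrite divfK.
Qed.

(** Two distinct points on the infinity line span it, so the secants contain
    the isotropic point I1. *)
Lemma tangent_infinity (a : analytic_curve R) (s : a) T :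
  tangent_line s T ->
  (exists2 u, val (curve_map s) = <[u]>%VS & hs u = 0) ->
  (forall N : set a, nbhs s N -> exists2 q, N q & curve_map q <> curve_map s /\
     exists2 v, val (curve_map q) = <[v]>%VS & hs v = 0) ->
  isotropic T.
Proof.
move=> tT [u eu su] H; left; apply: (tangent_contains tT) => N e sN e0.
have [q Nq [qs [v ev sv]]] := H N sN.
have nz (p : CP2 R) (x : 'rV[C]_3) : val p = <[x]>%VS -> x != 0.
  move=> e1; apply/eqP => x0; have := valP p; rewrite e1 x0 dim_vline eqxx //.
exists q, (I1 R); split=> //.
- by apply/eqP => E; apply: qs; rewrite E.
- have D0 : hz u * hw v - hw u * hz v != 0.
    rewrite subr_eq0; apply/eqP => E; apply: qs; apply/val_inj; rewrite ev eu.
    by apply/esym/proportional_line => //; [exact: nz eu|exact: nz ev].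
  rewrite /line_through eu ev.
  have -> : I1 R = (- 2 * hz v / (hz u * hw v - hw u * hz v)) *: u
                 + (2 * hz u / (hz u * hw v - hw u * hz v)) *: v.
    rewrite I1_coord; apply: homogeneous_inj;
      rewrite ?(hzL, hwL, hsL) ?(hzZ, hwZ, hsZ) ?(hz_row, hw_row, hs_row) ?zcZ ?wcZ ?zc_ew ?wc_ew ?su ?sv.
    - by field.
    - by field.
    - by rewrite mxE !mulr0 addr0.
  by apply: memv_add; apply: memvZ; exact: memv_line.
- by move=> j; rewrite subrr normr0.
Qed.

End TangentLimits.

(** * Regular parametrized arcs of a mirror *)

Section ArcDerivatives.
Variable K : numFieldType.

(** A regular arc is described by its slope m, which enters the reflection law,
    rather than by the derivative of z; then n carries the curvature. *)
Definition arc_derivatives (E : set K) (z w p m n : K -> K) :=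
  forall t, E t ->
    [/\ is_derive (t : K) (1 : K) z (m t * p t), is_derive (t : K) (1 : K) w (p t),
        is_derive (t : K) (1 : K) m (n t) &
        [/\ {for t, continuous p}, {for t, continuous n}, p t != 0 & m t != 0]].

Lemma arc_derivatives_sub (E F : set K) z w p m n : F `<=` E ->
  arc_derivatives E z w p m n -> arc_derivatives F z w p m n.
Proof. by move=> FE H t /FE; exact: H. Qed.

End ArcDerivatives.

Section Arcs.
Variable R : realType.
Local Notation C := (Cplx R).

Lemma continuous_recurrent_at (S : topologicalType) (D : set C) (s : C -> S) (t0 : C) :
  open D -> D t0 -> {for t0, continuous s} -> recurrent_at D s t0.
Proof.
move=> oD D0 cs N e sN e0.
have : nbhs t0 (D `&` s @^-1` N).
  by apply: filterI; [exact: open_nbhs_nbhs | exact: cs].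
move/nbhs_normP => [k /= k0 Hk].
have [l l0 [le lk]] := common_radius e0 k0.
have h0 : 0 < l / 2 by rewrite divr_gt0.
have hl : l / 2 < l by rewrite ltr_pdivrMr // ltr_pMr // ltr1n.
have [] := Hk (t0 + l / 2).
  by rewrite /ball_ /= opprD addrA subrr add0r normrN gtr0_norm // (lt_le_trans hl).
move=> Dt Nt; exists (t0 + l / 2); split => //.
  by rewrite -subr_eq0 addrC addKr lt0r_neq0.
by rewrite [_ - t0]addrC addKr gtr0_norm // (lt_le_trans hl).
Qed.

Definition arc_in (a : analytic_curve R) (V : set a) (s : C -> a) (D : set C)
    (z w p m n : C -> C) :=
  [/\ open D, D !=set0,
    forall t, D t -> [/\ V (s t), {for t, continuous s} &
      val (curve_map (s t)) = <[affine_pt (iso_pt (z t) (w t))]>%VS]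
    & arc_derivatives D z w p m n].

(** A chart is injective and open on its domain, hence it has a continuous
    inverse on the image. *)
Lemma chart_inverse (a : analytic_curve R) (c : chart R a) (V : set a) :
  open V -> V `<=` chart_dom c -> V !=set0 ->
  exists s : C -> a, forall q, V q -> s (c q) = q /\ {for c q, continuous s}.
Proof.
move=> oV Vc [p0 _].
pose s (t : C) := xget p0 (V `&` [set q | c q = t]).
have sK q : V q -> s (c q) = q.
  move=> Vq; rewrite /s; case: xgetP => [y _ [Vy /= cy]|/(_ q)]; last by case; split.
  by apply: (@chart_injective _ _ c) => //; rewrite inE; exact: Vc.
exists s => q Vq; split; first exact: sK.
move=> N; rewrite (sK q Vq) nbhsE => -[N' [oN' N'q] N'N].
have oW : open (V `&` N') by exact: openI.
have ocW := chart_open_map oW (subset_trans (@subIsetl _ _ _) Vc).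
have : nbhs (c q) (c @` (V `&` N')).
  by apply: open_nbhs_nbhs; split => //; exists q.
apply: filterS => _ [q' [Vq' N'q'] <-]; rewrite /= (sK q' Vq'); exact: N'N.
Qed.

Lemma affine_normal (Y : 'rV[C]_3) : hs Y != 0 ->
  <[Y]>%VS = <[affine_pt (iso_pt (hz Y / hs Y) (hw Y / hs Y))]>%VS.
Proof.
move=> s0.
have E : Y = hs Y *: affine_pt (iso_pt (hz Y / hs Y) (hw Y / hs Y)).
  by apply: homogeneous_inj; rewrite ?hzZ ?hwZ ?hsZ ?hz_aff ?hw_aff ?hs_aff ?zc_iso_pt ?wc_iso_pt;
    rewrite ?mulr1 // mulrC divfK.
apply/eqP; rewrite eqEsubv -!memvE {1}E memvZ ?memv_line //=.
by apply/vlineP; exists (hs Y)^-1; apply: (scalerI s0); rewrite scalerA divff // scale1r -E.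
Qed.

(** Near a point of V the homogeneous coordinates are analytic functions of a
    chart.  Successive points are chosen where nothing degenerates: the curve
    cannot stay on the infinity line, since its tangents would be isotropic; it
    cannot be stationary, since it is not locally constant; and then neither
    isotropic coordinate of its velocity vanishes, again since the tangents are
    not isotropic. *)
Lemma exists_arc (a : analytic_curve R) (V : set a) : open V -> V !=set0 ->
  (forall q, V q -> exists2 T, tangent_line q T & ~ isotropic T) ->
  exists s D z w p m n, @arc_in a V s D z w p m n.
Proof.
move=> oV [p0 Vp0] tan.
have [c ac cp0] := atlas_cover p0.
have [F [Fan FE]] := curve_holomorphic ac cp0.
have : nbhs p0 [set q | val (curve_map q) = <[F (c q)]>%VS] by exact: FE.
rewrite nbhsE => -[V1 [oV1 V1p0] V1F].
pose W := V `&` chart_dom c `&` V1.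
have oW : open W by apply: openI => //; apply: openI => //; exact: chart_open_dom.
have Wc : W `<=` chart_dom c by move=> q [[]].
have Wp0 : W p0 by [].
have [s sP] := chart_inverse oW Wc (ex_intro _ p0 Wp0).
have cW q : W q -> {for q, continuous c}.
  move=> Wq; have := @chart_continuous _ _ c.
  rewrite continuous_open_subspace; last exact: chart_open_dom.
  by apply; rewrite inE; exact: Wc.
have oO : open (c @` W) by exact: chart_open_map.
have smF (j : 'I_3) := smooth_analytic 2 (Fan j).
have [D0 D0p [smz [smw sms]]] : exists2 D : set C, nbhs (c p0) D &
   smooth 2 D (fun t => hz (F t)) /\ smooth 2 D (fun t => hw (F t)) /\
   smooth 2 D (fun t => hs (F t)).
  have [i0 [i1 [i2 Hzws]]] : exists i0 i1 i2 : 'I_3, forall Y : 'rV[C]_3,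
     [/\ hz Y = Y 0 i0 + 'i * Y 0 i1, hw Y = Y 0 i0 + (- 'i) * Y 0 i1 & hs Y = Y 0 i2].
    exists (lshift 1 0 : 'I_(2 + 1)), (lshift 1 1 : 'I_(2 + 1)), (rshift 2 0 : 'I_(2 + 1)) => Y.
    by rewrite /hz /hw /hs /zc /wc !mxE mulNr.
  have [E0 E0p s0] := smF i0; have [E1 E1p s1] := smF i1; have [E2 E2p s2] := smF i2.
  exists (E0 `&` E1 `&` E2); first by apply: filterI => //; exact: filterI.
  have {}s0 := smooth_sub (fun t (h : (E0 `&` E1 `&` E2) t) => h.1.1) s0.
  have {}s1 := smooth_sub (fun t (h : (E0 `&` E1 `&` E2) t) => h.1.2) s1.
  have {}s2 := smooth_sub (fun t (h : (E0 `&` E1 `&` E2) t) => h.2) s2.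
  have -> : (fun t => hz (F t)) = (fun t => F t 0 i0 + 'i * F t 0 i1).
    by apply/funext => t; have [] := Hzws (F t).
  have -> : (fun t => hw (F t)) = (fun t => F t 0 i0 + (- 'i) * F t 0 i1).
    by apply/funext => t; have [] := Hzws (F t).
  have -> : (fun t => hs (F t)) = (fun t => F t 0 i2).
    by apply/funext => t; have [] := Hzws (F t).
  split; first by apply: smoothD => //; apply: smoothM => //; exact: smooth_cst.
  by split=> //; apply: smoothD => //; apply: smoothM => //; exact: smooth_cst.
pose D1 := (c @` W) `&` D0°.
have oD1 : open D1 by apply: openI => //; exact: open_interior.
have D1p : D1 (c p0) by split; first by exists p0.
have D1sub : D1 `<=` D0 by move=> t [_ /interior_subset].
have curveF q : W q -> val (curve_map q) = <[F (c q)]>%VS by move=> [_ /V1F].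
have D1s t : D1 t -> [/\ W (s t), c (s t) = t, {for t, continuous s}
    & val (curve_map (s t)) = <[F t]>%VS].
  move=> [[q Wq <-] _]; have [sc cs] := sP q Wq; split=> //; rewrite sc //.
  exact: curveF.
have nearby q N E : W q -> nbhs q N -> nbhs (c q) E ->
    exists q', [/\ N q', W q', E (c q') & curve_map q' <> curve_map q].
  move=> Wq qN cE; apply: contrapT => H; apply: (@curve_nonconstant _ _ q).
  have nW : nbhs q W by exact: open_nbhs_nbhs.
  have nE : nbhs q (c @^-1` E) by exact: cW.
  apply: filterS (filterI qN (filterI nW nE)) => q' [Nq' [Wq' Eq']].
  by apply: contrapT => ne; apply: H; exists q'.
(* t1 is a parameter of an affine point, t2 of a point with non-zero velocity. *)
have [t1 D1t1 s1] : exists2 t, D1 t & hs (F t) != 0.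
  apply: contrapT => H.
  have hs0' t : D1 t -> hs (F t) = 0.
    by move=> Dt; apply/eqP/negPn/negP => ne; apply: H; exists t.
  have [T tT nT] := tan p0 Vp0; apply: nT; apply: (tangent_infinity tT).
    by exists (F (c p0)); [exact: curveF | exact: hs0'].
  move=> N sN; have [|q [Nq Wq Dq ne]] := nearby p0 N D1 Wp0 sN.
    exact: open_nbhs_nbhs.
  exists q => //; split=> //.
  by exists (F (c q)); [exact: curveF | exact: hs0'].
pose D2 := (D1 `&` [set t | hs (F t) != 0])°.
have oD2 : open D2 by exact: open_interior.
have D2sub t : D2 t -> D1 t /\ hs (F t) != 0 by move/interior_subset.
have D2t1 : D2 t1.
  apply: filterI; first exact: open_nbhs_nbhs.
  exact: (near_nonzero (smooth_continuous sms (D1sub _ D1t1)) s1).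
pose z t := hz (F t) / hs (F t); pose w t := hw (F t) / hs (F t).
have sub20 : D2 `<=` D0 by move=> t /D2sub[/D1sub].
have sV : smooth 2 D2 (fun t => (hs (F t))^-1).
  by apply: smoothV => [t /D2sub[]//|]; exact: smooth_sub sms.
have [z1 dz sz1] : smooth 2 D2 z by apply: smoothM => //; exact: smooth_sub smz.
have [w1 dw sw1] : smooth 2 D2 w by apply: smoothM => //; exact: smooth_sub smw.
have curveD2 t : D2 t -> val (curve_map (s t)) = <[affine_pt (iso_pt (z t) (w t))]>%VS.
  by move=> /D2sub[/D1s[_ _ _ ->]] /affine_normal.
have [t2 D2t2 nz2] : exists2 t, D2 t & (z1 t != 0) || (w1 t != 0).
  apply: contrapT => H.
  have z10 t : D2 t -> z1 t = 0.
    by move=> Dt; apply/eqP/negPn/negP => ne; apply: H; exists t => //; rewrite ne.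
  have w10 t : D2 t -> w1 t = 0.
    by move=> Dt; apply/eqP/negPn/negP => ne; apply: H; exists t => //; rewrite ne orbT.
  have : nbhs t1 D2 by exact: open_nbhs_nbhs.
  move/nbhs_normP => [k /= k0 Hk].
  have {}Hk t : `|t - t1| < k -> D2 t by move=> tk; apply: Hk; rewrite /ball_ /= distrC.
  have [Wt1 ct1 _ _] := D1s t1 D1t1.
  have kE : nbhs (c (s t1)) [set t | `|t - t1| < k].
    rewrite ct1; apply/nbhs_normP; exists k => // t; rewrite /ball_ /= distrC //.
  have [q [_ Wq qk]] := nearby (s t1) setT _ Wt1 filterT kE; apply.
  have [sq _] := sP q Wq.
  have e1 := curveD2 (c q) (Hk _ qk); rewrite sq in e1.
  have e2 := curveD2 t1 D2t1.
  have zc1 : z (c q) = z t1.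
    apply: (@zero_derivative_constant _ z t1 k (c q) _ qk) => v vk.
    by have := dz v (Hk v vk); rewrite (z10 v (Hk v vk)).
  have wc1 : w (c q) = w t1.
    apply: (@zero_derivative_constant _ w t1 k (c q) _ qk) => v vk.
    by have := dw v (Hk v vk); rewrite (w10 v (Hk v vk)).
  apply: val_inj; apply: etrans e1 _; rewrite zc1 wc1; exact: esym e2.
have [z2 w2] : z1 t2 != 0 /\ w1 t2 != 0.
  have [/D1s[Wt2 _ cst2 _] _] := D2sub _ D2t2.
  have [T tT nT] := tan (s t2) Wt2.1.1.
  have := tangent_derivative (continuous_recurrent_at oD2 D2t2 cst2) D2t2 curveD2 (dz _ D2t2) (dw _ D2t2) tT.
  move/(nonisotropic_direction nT); rewrite zc_iso_pt wc_iso_pt; apply.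
  apply: contraTneq nz2 => E.
  have ez : z1 t2 = 0 by rewrite -(zc_iso_pt (z1 t2) (w1 t2)) E zc0.
  have ew : w1 t2 = 0 by rewrite -(wc_iso_pt (z1 t2) (w1 t2)) E wc0.
  by rewrite ez ew eqxx.
pose D3 := (D2 `&` ([set t | z1 t != 0] `&` [set t | w1 t != 0]))°.
have D3sub t : D3 t -> [/\ D2 t, z1 t != 0 & w1 t != 0].
  by move/interior_subset => [? []].
have sub32 : D3 `<=` D2 by move=> t /D3sub[].
have D3t2 : D3 t2.
  apply: filterI; first exact: open_nbhs_nbhs.
  apply: filterI.
    exact: (near_nonzero (@smooth_continuous _ 1 _ _ sz1 _ D2t2) z2).
  exact: (near_nonzero (@smooth_continuous _ 1 _ _ sw1 _ D2t2) w2).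
have [n dm sn] : smooth 1 D3 (fun t => z1 t / w1 t).
  apply: smoothM; first exact: (@smooth_sub _ 1 _ _ _ sub32 sz1).
  by apply: smoothV => [t /D3sub[]//|]; exact: (@smooth_sub _ 1 _ _ _ sub32 sw1).
exists s, D3, z, w, w1, (fun t => z1 t / w1 t), n; split.
- exact: open_interior.
- by exists t2.
- move=> t /D3sub[D2t _ _]; have [D1t _] := D2sub t D2t.
  have [Wt _ cst _] := D1s t D1t.
  by split; [exact: Wt.1.1 | exact: cst | exact: curveD2].
move=> t D3t; have [D2t z1t w1t] := D3sub t D3t.
split; [by rewrite (divfK w1t); exact: dz | exact: dw | exact: dm | split=> //].
- exact: (@smooth_continuous _ 1 _ _ sw1 _ D2t).
- exact: sn D3t.
- by rewrite mulf_neq0 ?invr_eq0.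
Qed.

End Arcs.

(** * The contradiction when the second vertex moves *)

Section Slice.
Variable K : numFieldType.

Lemma derive_unique (f : K -> K) (t d d' : K) :
  is_derive t 1 f d -> is_derive t 1 f d' -> d = d'.
Proof. by move=> [_ <-] [_ <-]. Qed.

Lemma derive_zero (D : set K) (f : K -> K) (t d : K) : open D -> D t ->
  (forall x, D x -> f x = 0) -> is_derive t 1 f d -> d = 0.
Proof.
move=> oD Dt f0 df; apply: (derive_unique df).
apply: (@near_eq_is_derive K K K (cst 0) f t 1 0).
by have : nbhs t D by [exact: open_nbhs_nbhs]; apply: filterS => x /f0 ->.
Qed.

Lemma is_derive_constf (x a : K) : is_derive x 1 (fun=> a) 0.
Proof. exact: (@is_derive_cst K K K a x 1). Qed.
Lemma is_derive_addf (f g : K -> K) (x a b : K) : is_derive x 1 f a -> is_derive x 1 g b ->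
  is_derive x 1 (fun t => f t + g t) (a + b).
Proof. exact: is_deriveD. Qed.
Lemma is_derive_subf (f g : K -> K) (x a b : K) : is_derive x 1 f a -> is_derive x 1 g b ->
  is_derive x 1 (fun t => f t - g t) (a - b).
Proof. exact: is_deriveB. Qed.
Lemma is_derive_mulf (f g : K -> K) (x a b : K) : is_derive x 1 f a -> is_derive x 1 g b ->
  is_derive x 1 (fun t => f t * g t) (f x * b + g x * a).
Proof. exact: is_deriveM. Qed.
Lemma is_derive_sqrf (f : K -> K) (x a : K) : is_derive x 1 f a ->
  is_derive x 1 (fun t => f t ^+ 2) (2 * f x * a).
Proof.
move=> H; have := is_derive_mulf H H; rewrite (_ : f x * a + f x * a = 2 * f x * a); last by ring.
by congr is_derive; apply/funext => t; rewrite expr2.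
Qed.

Variables (z1 w1 p1 m1 n1 : K) (E : set K) (z2 w2 p2 m2 n2 : K -> K).
Hypothesis oE : open E.
Hypothesis E0 : E !=set0.
Hypothesis dz : forall u, E u -> is_derive (u : K) (1 : K) z2 (m2 u * p2 u).
Hypothesis dw : forall u, E u -> is_derive (u : K) (1 : K) w2 (p2 u).
Hypothesis dm : forall u, E u -> is_derive (u : K) (1 : K) m2 (n2 u).
Let c u := w2 u - w1.
Let D u := (z2 u - z1) / (w2 u - w1).
Hypothesis p10 : p1 != 0.
Hypothesis m10 : m1 != 0.
Hypothesis nondeg : forall u, E u -> [/\ p2 u != 0, D u != 0, c u != 0,
  m1 ^+ 2 != m2 u ^+ 2 & D u ^+ 2 != m1 ^+ 2 /\ D u ^+ 2 != m2 u ^+ 2].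

Let dc u : E u -> is_derive u 1 c (p2 u).
Proof. by move=> Eu; apply: is_derive_eq (is_derive_subf (dw Eu) (is_derive_constf u w1)) (subr0 _). Qed.

Lemma slope_derivative u : E u -> is_derive u 1 D (p2 u * (m2 u - D u) / c u).
Proof.
move=> Eu; have [_ _ c0 _ _] := nondeg Eu.
apply: is_derive_eq (is_derive_mulf (is_derive_subf (dz Eu) (is_derive_constf u z1)) (is_derive_invf c0 (dc Eu))) _.
by rewrite subr0 /D -/(c u); field; exact: c0.
Qed.

(** The first vertex is fixed.  The excluded combination of signs is reduced to
    a permitted one by exchanging the two mirrors. *)
Lemma no_signed_slice (s1 s2 : bool) : ~~ (s1 && ~~ s2) ->
  (forall u, E u -> curvature_defect ((-1) ^+ s1) (D u) (c u) m1 p1 n1 (m2 u) = 0) ->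
  (forall u, E u -> curvature_defect ((-1) ^+ s2) (D u) (- c u) (m2 u) (p2 u) (n2 u) m1 = 0) ->
  False.
Proof.
move=> s12 R1 R2; have [u0 Eu0] := E0.
set e1 := (-1) ^+ s1 in R1; set e2 := (-1) ^+ s2 in R2.
have log u : E u -> n2 u = - (p2 u * (D u - m2 u) ^+ 2 * (m2 u + e2 * m1)
       / (2 * c u * D u * (D u - e2 * m1))) /\
  2 * (D u - e2 * m1) * (- 4 * D u * (D u - m2 u) * (D u - e1 * m2 u)
     + 2 * (D u - m1) * (- D u * (D u - e1 * m2 u) + (D u - m2 u) * (D u - e1 * m2 u)
        + (D u - m2 u) * D u)) * (m1 + e1 * m2 u)
  - 2 * e1 * (D u - m1) * (D u - m2 u) ^+ 2 * (m2 u + e2 * m1) * (D u + m1) = 0.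
  move=> Eu; have [p20 D0 c0 m12 [Dm1 Dm2]] := nondeg Eu.
  apply: (@log_derivative K s1 s2 _ _ _ p1 n1) => //; [exact: R1|exact: R2|].
  have dD := slope_derivative Eu.
  have dem := is_derive_mulf (is_derive_constf u e1) (dm Eu).
  have dA := is_derive_mulf (is_derive_mulf (is_derive_constf u p1) (is_derive_sqrf (is_derive_subf dD (is_derive_constf u m1)))) (is_derive_addf (is_derive_constf u m1) dem).
  have dB := is_derive_mulf (is_derive_mulf (is_derive_mulf (is_derive_constf u (2 * n1)) (dc Eu)) dD) (is_derive_subf dD dem).
  rewrite -[RHS](derive_zero oE Eu R1 (is_derive_subf dA dB)) /curvature_defect_derivative -/e1.
  by ring.
have sg1 : e1 = if s1 then -1 else 1 by rewrite /e1; case: (s1); rewrite ?expr0 ?expr1.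
have sg2 : e2 = if s2 then -1 else 1 by rewrite /e2; case: (s2); rewrite ?expr0 ?expr1.
rewrite sg1 sg2 {e1 e2 sg1 sg2 R1 R2} in log.
have nz u : E u -> [/\ D u - m1 != 0, D u + m1 != 0, D u - m2 u != 0, D u + m2 u != 0 &
    m1 - m2 u != 0 /\ m1 + m2 u != 0].
  move=> /nondeg[_ _ _ /sqr_neq_factors[a b] [/sqr_neq_factors[a1 b1] /sqr_neq_factors[a2 b2]]]; by split.
have [p20 D0 c0 _ _] := nondeg Eu0; have [h1 h2 h3 h4 [h5 h6]] := nz _ Eu0.
have dD := slope_derivative Eu0; have dmu := dm Eu0.
case: s1 s2 s12 log => [] [] // _ log.
- have Q u : E u -> D u * (m2 u - m1) + (3 * m1) * m2 u - 3 * D u ^+ 2 = 0.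
    move=> Eu; have [_ g2 _ g4 [g5 _]] := nz _ Eu.
    by have [_ H] := log u Eu; exact: minus_minus_relation H.
  have [en _] := log _ Eu0.
  apply: (minus_minus_impossible D0 c0 p20 h3 h2 en); first by rewrite -[RHS](Q _ Eu0); ring.
  have dQ := is_derive_subf (is_derive_addf (is_derive_mulf dD (is_derive_subf dmu (is_derive_constf u0 m1))) (is_derive_mulf (is_derive_constf u0 (3 * m1)) dmu))
     (is_derive_mulf (is_derive_constf u0 3) (is_derive_sqrf dD)).
  rewrite -[RHS](derive_zero oE Eu0 Q dQ); ring.
- have Q u : E u -> D u * (m1 + 3 * m2 u) + m1 * (3 * m1 + m2 u) = 0.
    move=> Eu; have [_ g2 g3 _ _] := nz _ Eu.
    by have [_ H] := log u Eu; exact: plus_minus_relation H.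
  have [en _] := log _ Eu0.
  apply: (plus_minus_impossible D0 c0 p20 h3 h2 m10 en); first exact: Q.
  have dQ := is_derive_addf (is_derive_mulf dD (is_derive_addf (is_derive_constf u0 m1) (is_derive_mulf (is_derive_constf u0 3) dmu)))
    (is_derive_mulf (is_derive_constf u0 m1) (is_derive_addf (is_derive_constf u0 (3 * m1)) dmu)).
  rewrite -[RHS](derive_zero oE Eu0 Q dQ); ring.
- have [_ H] := log _ Eu0; exact: plus_plus_impossible H.
Qed.
End Slice.

(** * The contradiction on a box of pairs *)

Section Box.
Variable K : numFieldType.

Definition jointly_continuous (f : K -> K -> K) (t u : K) :=
  {for (t, u), continuous (fun x : K * K => f x.1 x.2)}.

Lemma jc_fst f t u : {for t, continuous f} -> jointly_continuous (fun x _ => f x) t u.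
Proof.
by move=> cf; apply: (@continuous_comp _ _ _ (@fst K K) f); [exact: cvg_fst | exact: cf].
Qed.
Lemma jc_snd f t u : {for u, continuous f} -> jointly_continuous (fun _ x => f x) t u.
Proof.
by move=> cf; apply: (@continuous_comp _ _ _ (@snd K K) f); [exact: cvg_snd | exact: cf].
Qed.
Lemma jc_cst a t u : jointly_continuous (fun _ _ => a) t u.
Proof. exact: cst_continuous. Qed.
Lemma jcD f g t u : jointly_continuous f t u -> jointly_continuous g t u ->
  jointly_continuous (fun x y => f x y + g x y) t u.
Proof. exact: continuousD. Qed.
Lemma jcB f g t u : jointly_continuous f t u -> jointly_continuous g t u ->
  jointly_continuous (fun x y => f x y - g x y) t u.
Proof. exact: continuousB. Qed.
Lemma jcN f t u : jointly_continuous f t u -> jointly_continuous (fun x y => - f x y) t u.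
Proof. exact: continuousN. Qed.
Lemma jcM f g t u : jointly_continuous f t u -> jointly_continuous g t u ->
  jointly_continuous (fun x y => f x y * g x y) t u.
Proof. exact: continuousM. Qed.
Lemma jcV f t u : f t u != 0 -> jointly_continuous f t u ->
  jointly_continuous (fun x y => (f x y)^-1) t u.
Proof. by move=> f0 cf; apply: continuousV. Qed.

Lemma jc_curvature_defect e D c m1 p1 n1 m2 (t u : K) :
  jointly_continuous D t u -> jointly_continuous c t u -> jointly_continuous m1 t u ->
  jointly_continuous p1 t u -> jointly_continuous n1 t u -> jointly_continuous m2 t u ->
  jointly_continuous (fun x y => curvature_defect e (D x y) (c x y) (m1 x y) (p1 x y) (n1 x y) (m2 x y)) t u.
Proof.
move=> cD cc cm1 cp1 cn1 cm2; rewrite /curvature_defect.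
have cem : jointly_continuous (fun x y => e * m2 x y) t u.
  by apply: jcM => //; exact: jc_cst.
have cx := jcB cD cm1.
apply: jcB.
  by apply: jcM; [apply: jcM => //; exact: (jcM cx cx) | exact: jcD].
apply: jcM; last exact: jcB.
by apply: jcM => //; apply: jcM => //; apply: jcM => //; exact: jc_cst.
Qed.

Lemma nonzero_box (f : K -> K -> K) (E F : set K) t u : open E -> open F -> E t -> F u ->
  jointly_continuous f t u -> f t u != 0 ->
  exists E' F', [/\ [/\ open E', E' t & E' `<=` E], [/\ open F', F' u & F' `<=` F] &
    forall x y, E' x -> F' y -> f x y != 0].
Proof.
move=> oE oF Et Fu cf f0.
have [[A B] /= [At Bu] AB] := near_nonzero cf f0.
exists (A° `&` E), (B° `&` F); split.
- by split; [apply: openI => //; exact: open_interior | split | move=> x []].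
- by split; [apply: openI => //; exact: open_interior | split | move=> x []].
move=> x y [/interior_subset Ax _] [/interior_subset By _].
exact: (AB (x, y)).
Qed.

(** If f is non-zero at one point of the box, it is non-zero on a smaller box, and
    g vanishes there. *)
Lemma vanishing_factor (f g : K -> K -> K) (E F : set K) :
  open E -> open F -> E !=set0 -> F !=set0 ->
  (forall t u, E t -> F u -> jointly_continuous f t u) ->
  (forall t u, E t -> F u -> f t u * g t u = 0) ->
  exists E' F', [/\ [/\ open E', E' !=set0 & E' `<=` E], [/\ open F', F' !=set0 & F' `<=` F] &
    (forall x y, E' x -> F' y -> f x y = 0) \/ (forall x y, E' x -> F' y -> g x y = 0)].
Proof.
move=> oE oF E0 F0 cf fg.
have [|H] := pselect (exists t u, [/\ E t, F u & f t u != 0]).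
  move=> [t [u [Et Fu ne]]].
  have [E' [F' [[oE' Et' sE] [oF' Fu' sF] H]]] := nonzero_box oE oF Et Fu (cf t u Et Fu) ne.
  exists E', F'; split; [split => // | split => // | right=> x y Ex Fy].
  - by exists t.
  - by exists u.
  by apply/eqP; have /eqP := fg x y (sE x Ex) (sF y Fy); rewrite mulf_eq0 (negPf (H x y Ex Fy)).
exists E, F; split; [by split|by split|left=> x y Ex Fy].
by apply/eqP/negPn/negP => ne; apply: H; exists x, y.
Qed.

(** On a smaller box both curvature identities hold with constant signs, and
    [no_signed_slice] applies to one of the two orders of the mirrors. *)
Lemma no_curvature_box (E F : set K) (z1 w1 p1 m1 n1 z2 w2 p2 m2 n2 : K -> K) :
  let c t u := w2 u - w1 t in
  let D t u := (z2 u - z1 t) / (w2 u - w1 t) in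
  open E -> open F -> E !=set0 -> F !=set0 ->
  arc_derivatives E z1 w1 p1 m1 n1 -> arc_derivatives F z2 w2 p2 m2 n2 ->
  (forall t u, E t -> F u -> [/\ D t u != 0, c t u != 0, m1 t ^+ 2 != m2 u ^+ 2,
     D t u ^+ 2 != m1 t ^+ 2 & D t u ^+ 2 != m2 u ^+ 2]) ->
  (forall t u, E t -> F u ->
     curvature_defect 1 (D t u) (c t u) (m1 t) (p1 t) (n1 t) (m2 u) *
     curvature_defect (-1) (D t u) (c t u) (m1 t) (p1 t) (n1 t) (m2 u) = 0) ->
  (forall t u, E t -> F u ->
     curvature_defect 1 (D t u) (- c t u) (m2 u) (p2 u) (n2 u) (m1 t) *
     curvature_defect (-1) (D t u) (- c t u) (m2 u) (p2 u) (n2 u) (m1 t) = 0) ->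
  False.
Proof.
move=> c D oE oF E0 F0 d1 d2 nd R1 R2.
have cz (f : K -> K) (g t : K) : is_derive (t : K) (1 : K) f g -> {for t, continuous f}.
  by move=> H; exact: (is_derive_continuous H).
have jc t u : E t -> F u -> jointly_continuous D t u /\ jointly_continuous c t u.
  move=> Et Fu; have [dz1 dw1 _ _] := d1 t Et; have [dz2 dw2 _ _] := d2 u Fu.
  have cc : jointly_continuous c t u by apply: jcB; [apply: jc_snd|apply: jc_fst]; apply: cz; eassumption.
  split => //; apply: jcM; last by apply: jcV => //; have [] := nd t u Et Fu.
  by apply: jcB; [apply: jc_snd|apply: jc_fst]; apply: cz; eassumption.
have [E1 [F1 [[oE1 E10 sE1] [oF1 F10 sF1] H1]]] : exists E' F',
    [/\ [/\ open E', E' !=set0 & E' `<=` E], [/\ open F', F' !=set0 & F' `<=` F] &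
    exists s : bool, forall t u, E' t -> F' u ->
      curvature_defect ((-1) ^+ s) (D t u) (c t u) (m1 t) (p1 t) (n1 t) (m2 u) = 0].
  have [t u Et Fu|E1 [F1 [a b H]]] := vanishing_factor oE oF E0 F0 _ R1.
    have [jD jcc] := jc t u Et Fu.
    have [_ _ dm1 [cp1 cn1 _ _]] := d1 t Et; have [_ _ dm2 _] := d2 u Fu.
    apply: jc_curvature_defect => //; [apply: jc_fst|apply: jc_fst|apply: jc_fst|apply: jc_snd] => //; apply: cz; eassumption.
  by exists E1, F1; split=> //; case: H => H; [exists false|exists true].
have {}R2 t u (Et : E1 t) (Fu : F1 u) := R2 t u (sE1 t Et) (sF1 u Fu).
have [E2 [F2 [[oE2 E20 sE2] [oF2 F20 sF2] H2]]] : exists E' F',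
    [/\ [/\ open E', E' !=set0 & E' `<=` E1], [/\ open F', F' !=set0 & F' `<=` F1] &
    exists s : bool, forall t u, E' t -> F' u ->
      curvature_defect ((-1) ^+ s) (D t u) (- c t u) (m2 u) (p2 u) (n2 u) (m1 t) = 0].
  have [t u /sE1 Et /sF1 Fu|E2 [F2 [a b H]]] := vanishing_factor oE1 oF1 E10 F10 _ R2.
    have [jD jcc] := jc t u Et Fu.
    have [_ _ dm2 [cp2 cn2 _ _]] := d2 u Fu; have [_ _ dm1 _] := d1 t Et.
    apply: jc_curvature_defect => //; [exact: jcN|apply: jc_snd|apply: jc_snd|apply: jc_snd|apply: jc_fst] => //; apply: cz; eassumption.
  by exists E2, F2; split=> //; case: H => H; [exists false|exists true].
have [s1 {}H1] := H1; have [s2 {}H2] := H2.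
have [t0 Et0] := E20; have [u0 Fu0] := F20.
have Es t : E2 t -> E t by move=> /sE2/sE1.
have Fs t : F2 t -> F t by move=> /sF2/sF1.
have [s12|] := boolP (~~ (s1 && ~~ s2)).
  have [_ _ _ [_ _ p10 m10]] := d1 t0 (Es _ Et0).
  apply: (@no_signed_slice K (z1 t0) (w1 t0) (p1 t0) (m1 t0) (n1 t0) F2 z2 w2 p2 m2 n2 oF2 F20 _ _ _ p10 m10 _ s1 s2 s12).
  - by move=> u /Fs/d2[].
  - by move=> u /Fs/d2[].
  - by move=> u /Fs/d2[].
  - move=> u /Fs Fu; have [_ _ _ [_ _ p20 _]] := d2 u Fu.
    by have [] := nd t0 u (Es _ Et0) Fu.
  - by move=> u Fu; apply: H1; [exact: sE2|exact: sF2].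
  - by move=> u Fu; apply: H2.
rewrite negbK => /andP[s1t s2f].
have [_ _ _ [_ _ p20 m20]] := d2 u0 (Fs _ Fu0).
have s21 : ~~ (s2 && ~~ s1) by rewrite s1t andbF.
have De t : (z1 t - z2 u0) / (w1 t - w2 u0) = D t u0.
  by rewrite /D -[z1 t - _]opprB -[w1 t - _]opprB invrN mulrNN.
have ce t : w1 t - w2 u0 = - c t u0 by rewrite /c opprB.
apply: (@no_signed_slice K (z2 u0) (w2 u0) (p2 u0) (m2 u0) (n2 u0) E2 z1 w1 p1 m1 n1 oE2 E20 _ _ _ p20 m20 _ s2 s1 s21).
- by move=> u /Es/d1[].
- by move=> u /Es/d1[].
- by move=> u /Es/d1[].
- move=> t /Es Et; have [_ _ _ [_ _ p10 _]] := d1 t Et; rewrite De ce.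
  have [? ? ? ? ?] := nd t u0 Et (Fs _ Fu0); split=> //; first by rewrite oppr_eq0.
  by rewrite eq_sym.
- by move=> t Et; rewrite De ce; apply: H2.
- move=> t Et; rewrite De ce opprK; apply: H1; [exact: sE2|exact: sF2].
Qed.
End Box.

(** * Triangular orbits *)

Section Triangle.
Variable R : realType.
Local Notation C := (Cplx R).

Definition reflects_at (a : analytic_curve R) (q : a) (x y : CP2 R) :=
  exists T, [/\ tangent_line q T, ~ isotropic T, line_through (curve_map q) x <> T,
    line_through (curve_map q) y <> T &
    symmetric_lines T (line_through (curve_map q) x) (line_through (curve_map q) y)].

(** Stated for points of three separate curves, so that the roles of the first
    two can be exchanged. *)
Definition triangle (a b c : analytic_curve R) (q1 : a) (q2 : b) (q3 : c) :=
  [/\ [/\ curve_map q1 <> curve_map q2, curve_map q1 <> curve_map q3 & curve_map q2 <> curve_map q3],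
    reflects_at q1 (curve_map q2) (curve_map q3),
    reflects_at q2 (curve_map q1) (curve_map q3) &
    reflects_at q3 (curve_map q1) (curve_map q2)].

Lemma reflects_atC (a : analytic_curve R) (q : a) x y : reflects_at q x y -> reflects_at q y x.
Proof.
by case=> T [h1 h2 h3 h4 h5]; exists T; split=> //; exact: symmetric_linesC.
Qed.

Lemma triangleC (a b c : analytic_curve R) (q1 : a) (q2 : b) (q3 : c) :
  triangle q1 q2 q3 -> triangle q2 q1 q3.
Proof.
case=> [[h12 h13 h23] r1 r2 r3]; split=> //; last exact: reflects_atC.
by split=> // h; apply: h12.
Qed.

Lemma dim_line_through (p q : CP2 R) : p <> q -> \dim (line_through p q) = 2%N.
Proof.
move=> pq; have dp := eqP (valP p); have dq := eqP (valP q).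
have := dimv_sum_cap (val p) (val q); rewrite /line_through dp dq => e.
suff c0 : \dim (val p :&: val q) = 0%N by rewrite c0 addn0 in e.
apply/eqP; rewrite -leqn0 leqNgt; apply/negP => cap.
apply: pq; apply/val_inj.
have ip : (val p :&: val q)%VS = val p.
  by apply/eqP; rewrite eqEdim capvSl dp.
have iq : (val p :&: val q)%VS = val q.
  by apply/eqP; rewrite eqEdim capvSr dq.
by rewrite -ip iq.
Qed.

Lemma dim_line_of (l : 'cV[C]_3) : l != 0 -> (\dim (line_of l) <= 2)%N.
Proof.
move=> l0; rewrite leqNgt; apply/negP => d3.
have full : line_of l = fullv.
  by apply/eqP; rewrite eqEdim subvf dimvf /dim /= mul1n.
move/negP: l0; apply; apply/eqP/colP => j.
have : (delta_mx 0 j : 'rV[C]_3) \in line_of l by rewrite full memvf.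
rewrite mem_line_of (bigD1 j) //= big1 => [|i ij]; last by rewrite mxE eqxx (negPf ij) mul0r.
by rewrite addr0 !mxE !eqxx mul1r => /eqP.
Qed.

Lemma line_eq_tangent (a : analytic_curve R) (q : a) T (x : CP2 R) :
  tangent_line q T -> curve_map q <> x -> (val x <= T)%VS ->
  line_through (curve_map q) x = T.
Proof.
move=> tT ne xT; apply/eqP; rewrite eqEdim dim_line_through //; apply/andP; split.
  apply/subvP => v /memv_addP[v1 v1q [v2 v2x ->]]; apply: memvD.
    exact: (tangent_point tT).
  exact: (subvP xT).
by have [l [l0 [l00 -> _ _]]] := tT; exact: dim_line_of.
Qed.

(** Besides the reflection law, the transversality of the side to the mirror
    is kept, as a statement on slopes. *)
Lemma arc_reflection (a : analytic_curve R) V s D z w p m n t (x y : CP2 R) z2 w2 Y :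
  @arc_in R a V s D z w p m n -> D t -> reflects_at (s t) x y ->
  curve_map (s t) <> x ->
  val x = <[affine_pt (iso_pt z2 w2)]>%VS -> val y = <[Y]>%VS ->
  (hz Y - hs Y * z t) * (z2 - z t) = m t ^+ 2 * (hw Y - hs Y * w t) * (w2 - w t) /\
  z2 - z t <> m t * (w2 - w t).
Proof.
move=> [oD _ arc der] Dt [T [tT nT xT _ sym]] ne ex ey.
have [_ cs es] := arc t Dt; have [dz dw _ [_ _ p0 m0]] := der t Dt.
have curves x' (Dx : D x') : val (curve_map (s x')) = <[affine_pt (iso_pt (z x') (w x'))]>%VS.
  by have [] := arc x' Dx.
have dT := tangent_derivative (continuous_recurrent_at oD Dt cs) Dt curves dz dw tT.
have aT : affine_pt (iso_pt (z t) (w t)) \in T.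
  by apply: (tangent_point tT); rewrite es memv_line.
have := reflection_law sym es ex ey aT dT; rewrite !zc_iso_pt !wc_iso_pt => law; split.
  apply: (mulIf (expf_neq0 2 p0)); rewrite law ?mulf_neq0 //; ring.
move=> E; apply: xT; apply: (line_eq_tangent tT ne).
rewrite ex -memvE.
have -> : affine_pt (iso_pt z2 w2) = affine_pt (iso_pt (z t) (w t)) + ((w2 - w t) / p t) *: infinite_pt (iso_pt (m t * p t) (p t)).
  apply: homogeneous_inj.
  - by rewrite hzD hzZ !hz_aff hz_inf !zc_iso_pt mulrCA divfK // -E; ring.
  - by rewrite hwD hwZ !hw_aff hw_inf !wc_iso_pt divfK //; ring.
  - by rewrite hsD hsZ !hs_aff hs_inf mulr0 addr0.
by rewrite memvD // memvZ.
Qed.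
End Triangle.

(** * The third vertex *)

Section Apex.
Variable K : numFieldType.
Implicit Types z w m : K.

(** These are the coordinates of the common point of the line through
    (z1, w1) of slope m1^2 / D and the line through (z2, w2) of slope m2^2 / D,
    where D is the slope of the line joining these two points. *)
Definition apex_w z1 w1 m1 z2 w2 m2 : K :=
  (((z2 - z1) / (w2 - w1)) ^+ 2 * (w2 - w1) + m1 ^+ 2 * w1 - m2 ^+ 2 * w2)
    / (m1 ^+ 2 - m2 ^+ 2).
Definition apex_z z1 w1 m1 z2 w2 m2 : K :=
  z2 + m2 ^+ 2 * (w2 - w1) / (z2 - z1) * (apex_w z1 w1 m1 z2 w2 m2 - w2).

(** For S = 0 the two laws would give the point at infinity two distinct slopes
    m1^2 / D and m2^2 / D. *)
Lemma apex_unique z1 w1 m1 z2 w2 m2 (Z W S : K) :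
  z2 - z1 != 0 -> w2 - w1 != 0 -> m1 ^+ 2 != m2 ^+ 2 ->
  ~ (Z = 0 /\ W = 0 /\ S = 0) ->
  (Z - S * z1) * (z2 - z1) = m1 ^+ 2 * (W - S * w1) * (w2 - w1) ->
  (Z - S * z2) * (z2 - z1) = m2 ^+ 2 * (W - S * w2) * (w2 - w1) ->
  [/\ S != 0, Z / S = apex_z z1 w1 m1 z2 w2 m2 & W / S = apex_w z1 w1 m1 z2 w2 m2].
Proof.
move=> dz dw dm nz O1 O2.
have dm' : m1 ^+ 2 - m2 ^+ 2 != 0 by rewrite subr_eq0.
have S0 : S != 0.
  apply/eqP => S0; apply: nz; rewrite S0 !mul0r !subr0 in O1 O2 *.
  have W0 : W = 0.
    apply: (mulIf (mulf_neq0 dm' dw)); rewrite mul0r -[RHS](subrr (Z * (z2 - z1))) {1}O1 O2; ring.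
  split=> //; apply: (mulIf dz); rewrite O1 W0; ring.
have eW : W / S = apex_w z1 w1 m1 z2 w2 m2.
  apply: (mulIf (mulf_neq0 (mulf_neq0 dm' dw) S0)); rewrite /apex_w.
  have -> : W / S * ((m1 ^+ 2 - m2 ^+ 2) * (w2 - w1) * S) =
    m1 ^+ 2 * (W - S * w1) * (w2 - w1) - m2 ^+ 2 * (W - S * w2) * (w2 - w1)
    + S * (w2 - w1) * (m1 ^+ 2 * w1 - m2 ^+ 2 * w2) by field.
  by rewrite -O1 -O2; field; rewrite dw dm'.
split=> //; rewrite /apex_z -eW; apply: (mulIf (mulf_neq0 dz S0)).
have -> : Z / S * ((z2 - z1) * S) = (Z - S * z2) * (z2 - z1) + S * z2 * (z2 - z1) by field.
by rewrite O2; field; rewrite ?S0 ?dz.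
Qed.

(** If D^2 = m1^2, the side is its own mirror image at the first vertex, so the
    third vertex is on it; the law at the second vertex then makes it coincide
    with that vertex. *)
Lemma apex_nondegenerate z1 w1 m1 z2 w2 m2 z3 w3 :
  z2 - z1 != 0 -> w2 - w1 != 0 -> m1 ^+ 2 != m2 ^+ 2 ->
  (z3 - z1) * (z2 - z1) = m1 ^+ 2 * (w3 - w1) * (w2 - w1) ->
  (z3 - z2) * (z2 - z1) = m2 ^+ 2 * (w3 - w2) * (w2 - w1) ->
  ~ (z3 = z2 /\ w3 = w2) -> ~ (z3 = z1 /\ w3 = w1) ->
  let D := (z2 - z1) / (w2 - w1) in D ^+ 2 != m1 ^+ 2 /\ D ^+ 2 != m2 ^+ 2.
Proof.
move=> dz dw dm O1 O2 n2 n1 D.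
have dm' : m1 ^+ 2 - m2 ^+ 2 != 0 by rewrite subr_eq0.
have ez : z2 - z1 = D * (w2 - w1) by rewrite /D divfK.
split; apply/eqP => E.
  apply: n2; have w32 : w3 = w2.
    apply/eqP; rewrite -subr_eq0; apply/eqP.
    apply: (mulIf (mulf_neq0 dm' dw)); rewrite mul0r.
    have -> : (w3 - w2) * ((m1 ^+ 2 - m2 ^+ 2) * (w2 - w1)) =
      m1 ^+ 2 * (w3 - w1) * (w2 - w1) - m2 ^+ 2 * (w3 - w2) * (w2 - w1)
      - m1 ^+ 2 * (w2 - w1) ^+ 2 by ring.
    by rewrite -O1 -O2 -E -exprMn -ez; ring.
  split=> //; apply/eqP; rewrite -subr_eq0; apply/eqP; apply: (mulIf dz).
  by rewrite O2 w32; ring.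
apply: n1; have w31 : w3 = w1.
  apply/eqP; rewrite -subr_eq0; apply/eqP.
  apply: (mulIf (mulf_neq0 dm' dw)); rewrite mul0r.
  have -> : (w3 - w1) * ((m1 ^+ 2 - m2 ^+ 2) * (w2 - w1)) =
    m1 ^+ 2 * (w3 - w1) * (w2 - w1) - m2 ^+ 2 * (w3 - w2) * (w2 - w1)
    - m2 ^+ 2 * (w2 - w1) ^+ 2 by ring.
  by rewrite -O1 -O2 -E -exprMn -ez; ring.
split=> //; apply/eqP; rewrite -subr_eq0; apply/eqP; apply: (mulIf dz).
by rewrite O1 w31; ring.
Qed.
End Apex.

Section ThirdVertex.
Variable R : realType.
Local Notation C := (Cplx R).
Variables (a b c : analytic_curve R) (V1 : set a) (s1 : C -> a) (E : set C)
  (z1 w1 p1 m1 n1 : C -> C) (V2 : set b) (s2 : C -> b) (F : set C)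
  (z2 w2 p2 m2 n2 : C -> C).
Hypothesis A1 : arc_in V1 s1 E z1 w1 p1 m1 n1.
Hypothesis A2 : arc_in V2 s2 F z2 w2 p2 m2 n2.

Lemma CP2_generator (x : CP2 R) : exists2 Y : 'rV[C]_3, val x = <[Y]>%VS & Y != 0.
Proof.
have [Y eY] : exists Y, val x = <[Y]>%VS.
  have d1 := eqP (valP x); exists (vpick (val x)).
  apply/esym/eqP; rewrite eqEdim -memvE memv_pick d1 dim_vline.
  have : val x != 0%VS by apply/eqP => x0; rewrite x0 dimv0 in d1.
  by rewrite -vpick0 => ->.
exists Y => //; apply/eqP => Y0; have := valP x.
by rewrite eY Y0 dim_vline eqxx.
Qed.

Lemma third_vertex_law t u (q : c) Y : E t -> F u -> triangle (s1 t) (s2 u) q ->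
  val (curve_map q) = <[Y]>%VS ->
  [/\ (hz Y - hs Y * z1 t) * (z2 u - z1 t) = m1 t ^+ 2 * (hw Y - hs Y * w1 t) * (w2 u - w1 t),
      (hz Y - hs Y * z2 u) * (z2 u - z1 t) = m2 u ^+ 2 * (hw Y - hs Y * w2 u) * (w2 u - w1 t)
    & z2 u - z1 t <> m2 u * (w2 u - w1 t)].
Proof.
move=> Et Fu [[n12 n13 n23] r1 r2 _] eY.
have e1 : val (curve_map (s1 t)) = <[affine_pt (iso_pt (z1 t) (w1 t))]>%VS.
  by case: A1 => _ _ /(_ t Et)[].
have e2 : val (curve_map (s2 u)) = <[affine_pt (iso_pt (z2 u) (w2 u))]>%VS.
  by case: A2 => _ _ /(_ u Fu)[].
have [l1 _] := arc_reflection A1 Et r1 n12 e2 eY.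
have [l2 h2] := arc_reflection A2 Fu r2 (fun h => n12 (esym h)) e1 eY.
split=> //.
  by rewrite -[z2 u - _]opprB mulrN l2; ring.
move=> h; apply: h2; rewrite -opprB h; ring.
Qed.

Lemma third_vertex t u (q : c) : E t -> F u -> triangle (s1 t) (s2 u) q ->
  z2 u - z1 t != 0 -> w2 u - w1 t != 0 -> m1 t ^+ 2 != m2 u ^+ 2 ->
  let z3 := apex_z (z1 t) (w1 t) (m1 t) (z2 u) (w2 u) (m2 u) in
  let w3 := apex_w (z1 t) (w1 t) (m1 t) (z2 u) (w2 u) (m2 u) in
  let D := (z2 u - z1 t) / (w2 u - w1 t) in
  [/\ val (curve_map q) = <[affine_pt (iso_pt z3 w3)]>%VS,
      (z3 - z1 t) * (z2 u - z1 t) = m1 t ^+ 2 * (w3 - w1 t) * (w2 u - w1 t),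
      (z3 - z2 u) * (z2 u - z1 t) = m2 u ^+ 2 * (w3 - w2 u) * (w2 u - w1 t)
    & D ^+ 2 != m1 t ^+ 2 /\ D ^+ 2 != m2 u ^+ 2].
Proof.
move=> Et Fu tr dz dw dm z3 w3 D.
have [Y eY Y0] := CP2_generator (curve_map q).
have [L1 L2 _] := third_vertex_law Et Fu tr eY.
have [|S0 ez ew] := apex_unique dz dw dm _ L1 L2.
  case=> h1 [h2 h3]; move/eqP: Y0; apply; apply: homogeneous_inj;
  by rewrite ?h1 ?h2 ?h3 ?hz0 ?hw0 ?hs0.
have e3 : val (curve_map q) = <[affine_pt (iso_pt z3 w3)]>%VS.
  by rewrite eY (affine_normal S0) ez ew.
have [] := third_vertex_law Et Fu tr e3.
rewrite hz_aff hw_aff hs_aff zc_iso_pt wc_iso_pt !mul1r => O1 O2 _.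
have [[_ n13 n23] _ _ _] := tr.
have e1 : val (curve_map (s1 t)) = <[affine_pt (iso_pt (z1 t) (w1 t))]>%VS.
  by case: A1 => _ _ /(_ t Et)[].
have e2 : val (curve_map (s2 u)) = <[affine_pt (iso_pt (z2 u) (w2 u))]>%VS.
  by case: A2 => _ _ /(_ u Fu)[].
split=> //; apply: (apex_nondegenerate dz dw dm O1 O2).
  by move=> [h1 h2]; apply: n23; apply: val_inj; apply: etrans e2 _; rewrite -h1 -h2; exact: esym e3.
by move=> [h1 h2]; apply: n13; apply: val_inj; apply: etrans e1 _; rewrite -h1 -h2; exact: esym e3.
Qed.

End ThirdVertex.

(** * The motion of the third vertex *)

Section Slices.
Variable R : realType.
Local Notation C := (Cplx R).
Variables (a b c : analytic_curve R) (V1 : set a) (s1 : C -> a) (E : set C)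
  (z1 w1 p1 m1 n1 : C -> C) (V2 : set b) (s2 : C -> b) (F : set C)
  (z2 w2 p2 m2 n2 : C -> C).
Hypothesis A1 : arc_in V1 s1 E z1 w1 p1 m1 n1.
Hypothesis A2 : arc_in V2 s2 F z2 w2 p2 m2 n2.
Variable u : C.
Hypothesis Fu : F u.
Hypothesis dz : forall t, E t -> z2 u - z1 t != 0.
Hypothesis dw : forall t, E t -> w2 u - w1 t != 0.
Variable s3 : C -> c.
Hypothesis tri : forall t, E t -> triangle (s1 t) (s2 u) (s3 t).

(** The branch s3 of the third mirror is an arbitrary function of t; the second
    countability of the mirror provides the recurrence. *)
Lemma recurrence_in_ball (t : C) (r : C) (G : set C) : 0 < r -> (forall x, `|x - t| < r -> G x) ->
  exists2 t0, G t0 & recurrent_at G s3 t0.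
Proof.
move=> r0 Hr.
have [t0 t0r rec] := recurrent_parameter s3 t (carrier_countable c) r0.
exists t0; first exact: Hr.
move=> N e sN e0; have [x [xr xt xe Nx]] := rec N e sN e0.
by exists x; split=> //; exact: Hr.
Qed.

(** If the product were non-zero at t', it would be so on a ball around t'.  This
    ball contains a recurrent parameter t0, where the velocity of the third
    vertex is tangent to the third mirror and one of the factors vanishes. *)
Lemma curvature_defect_slice : (forall t, E t -> m1 t ^+ 2 != m2 u ^+ 2) -> forall t, E t ->
  curvature_defect 1 ((z2 u - z1 t) / (w2 u - w1 t)) (w2 u - w1 t) (m1 t) (p1 t) (n1 t) (m2 u) *
  curvature_defect (-1) ((z2 u - z1 t) / (w2 u - w1 t)) (w2 u - w1 t) (m1 t) (p1 t) (n1 t) (m2 u) = 0.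
Proof.
move=> dm t' Et'; apply/eqP/negPn/negP => ne.
have [oE _ _ d1] := A1; have [_ _ _ d2] := A2.
pose D t := (z2 u - z1 t) / (w2 u - w1 t).
pose f t := curvature_defect 1 (D t) (w2 u - w1 t) (m1 t) (p1 t) (n1 t) (m2 u) *
  curvature_defect (-1) (D t) (w2 u - w1 t) (m1 t) (p1 t) (n1 t) (m2 u).
have sz : smooth 1 E z1.
  exists (fun t => m1 t * p1 t); first by move=> t /d1[].
  move=> t /d1[_ _ dm1 [cp _ _ _]]; apply: continuousM; [exact: (is_derive_continuous dm1)|exact: cp].
have sw : smooth 1 E w1.
  by exists p1 => t /d1[_ ? _ []].
have sm : smooth 1 E m1.
  by exists n1 => t /d1[_ _ ? []].
have sN1 (g : C -> C) k : smooth k E g -> smooth k E (fun t => -1 * g t).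
  by move=> sg; apply: smoothM; [exact: smooth_cst|exact: sg].
have sB (g h : C -> C) k : smooth k E g -> smooth k E h -> smooth k E (fun t => g t - h t).
  move=> sg sh; have := smoothD sg (sN1 _ _ sh).
  by congr smooth; apply/funext => t; rewrite mulN1r.
have sX (g : C -> C) k : smooth k E g -> smooth k E (fun t => g t ^+ 2).
  move=> sg; have := smoothM sg sg.
  by congr smooth; apply/funext => t; rewrite expr2.
have sdz : smooth 1 E (fun t => z2 u - z1 t) by apply: sB; [exact: smooth_cst|exact: sz].
have sdw : smooth 1 E (fun t => w2 u - w1 t) by apply: sB; [exact: smooth_cst|exact: sw].
have sD : smooth 1 E D by apply: smoothM; [exact: sdz|apply: smoothV; [exact: dw|exact: sdw]].
pose z3 t := apex_z (z1 t) (w1 t) (m1 t) (z2 u) (w2 u) (m2 u).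
pose w3 t := apex_w (z1 t) (w1 t) (m1 t) (z2 u) (w2 u) (m2 u).
have sw3 : smooth 1 E w3.
  apply: smoothM.
    apply: sB; last by apply: smooth_cst.
    apply: smoothD; first by apply: smoothM; [apply: sX; exact: sD|exact: sdw].
    by apply: smoothM; [apply: sX; exact: sm|exact: sw].
  apply: smoothV; first by move=> t /dm; rewrite subr_eq0.
  by apply: sB; [apply: sX; exact: sm|exact: smooth_cst].
have sz3 : smooth 1 E z3.
  apply: smoothD; first exact: smooth_cst.
  apply: smoothM; last by apply: sB; [exact: sw3|exact: smooth_cst].
  apply: smoothM; last by apply: smoothV; [exact: dz|exact: sdz].
  by apply: smoothM; [exact: smooth_cst|exact: sdw].
have cf : {for t', continuous f}.
  have cont (g : C -> C) k : smooth k E g -> {for t', continuous g}.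
    by move=> sg; exact: (smooth_continuous sg Et').
  have [_ _ _ [cp cn _ _]] := d1 t' Et'.
  have cE (e : C) : {for t', continuous (fun t => curvature_defect e (D t) (w2 u - w1 t) (m1 t) (p1 t) (n1 t) (m2 u))}.
    have cem : {for t', continuous (fun t => e * m2 u)} by exact: cst_continuous.
    have cD := cont _ _ sD; have cm := cont _ _ sm; have cw := cont _ _ sdw.
    have cx : {for t', continuous (fun t => D t - m1 t)} by exact: (continuousB cD cm).
    rewrite /curvature_defect; apply: continuousB.
      apply: continuousM; last exact: (continuousD cm cem).
      by apply: continuousM; [exact: cp|exact: (continuousM cx cx)].
    apply: continuousM; last exact: (continuousB cD cem).
    apply: continuousM; last exact: cD.
    apply: continuousM; last exact: cw.
    by apply: continuousM; [exact: cst_continuous|exact: cn].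
  by apply: continuousM; exact: cE.
have : nbhs t' (E `&` [set t | f t != 0]).
  apply: filterI; first exact: open_nbhs_nbhs.
  exact: near_nonzero.
move=> /nbhs_normP[r /= r0 Hr].
have [|t0 [Et0 ft0] rec] := @recurrence_in_ball t' r (E `&` [set t | f t != 0]) r0.
  by move=> x xr; apply: Hr; rewrite /ball_ /= distrC.
have {}rec : recurrent_at E s3 t0.
  by move=> N e sN e0; have [x [[Ex _] ? ? ?]] := rec N e sN e0; exists x.
have vert t (Et : E t) := third_vertex A1 A2 Et Fu (tri Et) (dz Et) (dw Et) (dm t Et).
have c3 t : E t -> val (curve_map (s3 t)) = <[affine_pt (iso_pt (z3 t) (w3 t))]>%VS.
  by move=> /vert[].
case: sz3 => zt /(_ _ Et0) dz3 _; case: sw3 => wt /(_ _ Et0) dw3 _.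
have [dz1 dw1 dm1 [_ _ p10 m10]] := d1 t0 Et0.
have [_ _ _ [_ _ _ m20]] := d2 u Fu.
have [_ O1 O2 [nd1 nd2]] := vert t0 Et0.
have dZ := is_derive_subf (is_derive_constf t0 (z2 u)) dz1; have dW := is_derive_subf (is_derive_constf t0 (w2 u)) dw1.
have G1 := is_derive_subf (is_derive_mulf (is_derive_subf dz3 dz1) dZ) (is_derive_mulf (is_derive_mulf (is_derive_sqrf dm1) (is_derive_subf dw3 dw1)) dW).
have G2 := is_derive_subf (is_derive_mulf (is_derive_subf dz3 (is_derive_constf t0 (z2 u))) dZ)
  (is_derive_mulf (is_derive_mulf (is_derive_constf t0 (m2 u ^+ 2)) (is_derive_subf dw3 (is_derive_constf t0 (w2 u)))) dW).
have Z1 t : E t -> (z3 t - z1 t) * (z2 u - z1 t) - m1 t ^+ 2 * (w3 t - w1 t) * (w2 u - w1 t) = 0.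
  by move=> /vert[_ -> _ _]; rewrite subrr.
have Z2 t : E t -> (z3 t - z2 u) * (z2 u - z1 t) - m2 u ^+ 2 * (w3 t - w2 u) * (w2 u - w1 t) = 0.
  by move=> /vert[_ _ -> _]; rewrite subrr.
have {}G1 := derive_zero oE Et0 Z1 G1; have {}G2 := derive_zero oE Et0 Z2 G2.
have dE1 : (zt t0 - m1 t0 * p1 t0) * (z2 u - z1 t0) - (z3 t0 - z1 t0) * (m1 t0 * p1 t0) =
    2 * m1 t0 * n1 t0 * (w3 t0 - w1 t0) * (w2 u - w1 t0)
    + m1 t0 ^+ 2 * (wt t0 - p1 t0) * (w2 u - w1 t0) - m1 t0 ^+ 2 * (w3 t0 - w1 t0) * p1 t0.
  by apply/eqP; rewrite -subr_eq0 -[X in _ == X]G1; apply/eqP; ring.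
have dE2 : zt t0 * (z2 u - z1 t0) - (z3 t0 - z2 u) * (m1 t0 * p1 t0) =
    m2 u ^+ 2 * wt t0 * (w2 u - w1 t0) - m2 u ^+ 2 * (w3 t0 - w2 u) * p1 t0.
  by apply/eqP; rewrite -subr_eq0 -[X in _ == X]G2; apply/eqP; ring.
have S3 : zt t0 ^+ 2 * ((w1 t0 - w3 t0) * (w2 u - w3 t0)) =
          wt t0 ^+ 2 * ((z1 t0 - z3 t0) * (z2 u - z3 t0)).
  have [_ _ _ [T [tT nT _ _ sym]]] := tri Et0.
  have dT := tangent_derivative rec Et0 c3 dz3 dw3 tT.
  have aT : affine_pt (iso_pt (z3 t0) (w3 t0)) \in T.
    by apply: (tangent_point tT); rewrite c3 // memv_line.
  have [v0|v0] := eqVneq (iso_pt (zt t0) (wt t0)) 0.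
    have -> : zt t0 = 0 by rewrite -(zc_iso_pt (zt t0) (wt t0)) v0 zc0.
    have -> : wt t0 = 0 by rewrite -(wc_iso_pt (zt t0) (wt t0)) v0 wc0.
    by rewrite !expr2 !mul0r.
  have [zt0 wt0] := nonisotropic_direction nT dT v0.
  have e1 : val (curve_map (s1 t0)) = <[affine_pt (iso_pt (z1 t0) (w1 t0))]>%VS.
    by case: A1 => _ _ /(_ _ Et0)[].
  have e2 : val (curve_map (s2 u)) = <[affine_pt (iso_pt (z2 u) (w2 u))]>%VS.
    by case: A2 => _ _ /(_ _ Fu)[].
  have := reflection_law sym (c3 t0 Et0) e1 e2 aT dT zt0 wt0.
  by rewrite hz_aff hw_aff hs_aff !zc_iso_pt !wc_iso_pt !mul1r => law; rewrite [X in _ = X]mulrC [(z1 t0 - _) * _]mulrC law; ring.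
move/negP: ft0; apply; rewrite /f mulf_eq0.
have [E0|E0] := @curvature_defect_of_velocity _ (z1 t0) (w1 t0) (p1 t0) (m1 t0) (n1 t0)
  (z2 u) (w2 u) (m2 u) (z3 t0) (w3 t0) (zt t0) (wt t0)
  (dz Et0) (dw Et0) m10 m20 (dm t0 Et0) nd1 nd2 O1 O2 dE1 dE2 S3.
  by apply/orP; left; apply/eqP.
by apply/orP; right; apply/eqP.
Qed.

(** Subtracting the two reflection laws, whose slopes agree, puts the third
    vertex on the infinity line.  It is the direction of slope m2^2 / D, which
    moves because the derivative of D is a multiple of D - m1. *)
Lemma no_parallel : E !=set0 -> (forall t, E t -> m1 t ^+ 2 = m2 u ^+ 2) ->
  (forall t, E t -> ((z2 u - z1 t) / (w2 u - w1 t)) ^+ 2 != m1 t ^+ 2) -> False.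
Proof.
move=> [t' Et'] dm nD.
have [oE _ _ d1] := A1; have [_ _ _ d2] := A2.
have [_ _ _ [_ _ _ m20]] := d2 u Fu.
pose D t := (z2 u - z1 t) / (w2 u - w1 t).
have inf t : E t -> exists2 Y, val (curve_map (s3 t)) = <[Y]>%VS &
    [/\ hs Y = 0, hw Y != 0 & hz Y * D t = m2 u ^+ 2 * hw Y].
  move=> Et; have [Y eY Y0] := CP2_generator (curve_map (s3 t)).
  exists Y => //; have [L1 L2 _] := third_vertex_law A1 A2 Et Fu (tri Et) eY.
  have ez : z2 u - z1 t = D t * (w2 u - w1 t) by rewrite /D divfK // dw.
  have S0 : hs Y = 0.
    have k0 : (D t ^+ 2 - m1 t ^+ 2) * (w2 u - w1 t) ^+ 2 != 0.
      by rewrite mulf_neq0 ?expf_neq0 ?dw // subr_eq0; exact: nD.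
    apply: (mulIf k0); rewrite mul0r.
    have -> : hs Y * ((D t ^+ 2 - m1 t ^+ 2) * (w2 u - w1 t) ^+ 2) =
      ((hz Y - hs Y * z1 t) * (D t * (w2 u - w1 t)) - m1 t ^+ 2 * (hw Y - hs Y * w1 t) * (w2 u - w1 t))
      - ((hz Y - hs Y * z2 u) * (D t * (w2 u - w1 t)) - m1 t ^+ 2 * (hw Y - hs Y * w2 u) * (w2 u - w1 t))
      + hs Y * (D t * (w2 u - w1 t)) * (D t * (w2 u - w1 t) - (z2 u - z1 t)) by ring.
    by rewrite -ez L1 L2 (dm t Et); ring.
  rewrite S0 !mul0r !subr0 ez in L1.
  have eD : hz Y * D t = m2 u ^+ 2 * hw Y.
    by apply: (mulIf (dw Et)); rewrite -mulrA L1 (dm t Et); ring.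
  split=> //; apply/eqP => W0; move/eqP: Y0; apply.
  have D0 : D t != 0 by rewrite mulf_neq0 ?invr_eq0 ?dz ?dw.
  have Z0 : hz Y = 0 by apply: (mulIf D0); rewrite eD W0 mulr0 mul0r.
  by apply: homogeneous_inj; rewrite ?Z0 ?W0 ?S0 ?hz0 ?hw0 ?hs0.
have : nbhs t' E by exact: open_nbhs_nbhs.
move=> /nbhs_normP[r /= r0 Hr].
have [|t0 Et0 rec] := @recurrence_in_ball t' r E r0.
  by move=> x xr; apply: Hr; rewrite /ball_ /= distrC.
have [dz1 dw1 _ [_ _ p10 m10]] := d1 t0 Et0.
have dV := @is_derive_invf _ (fun t => w2 u - w1 t) t0 _ (dw Et0) (is_derive_subf (is_derive_constf t0 (w2 u)) dw1).
have dD := is_derive_mulf (is_derive_subf (is_derive_constf t0 (z2 u)) dz1) dV.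
set D' := _ + _ in dD.
have D'0 : D' != 0.
  have -> : D' = p1 t0 * (D t0 - m1 t0) / (w2 u - w1 t0).
    by rewrite /D' /D; field; exact: dw.
  by rewrite !mulf_neq0 ?invr_eq0 ?dw //; have [] := sqr_neq_factors (nD t0 Et0).
have D'0' : 0 < `|D'| by rewrite normr_gt0.
have [k k0 Hk] := is_derive_quotient_near dD D'0'.
have [T [tT nT _ _ _]] : reflects_at (s3 t0) (curve_map (s1 t0)) (curve_map (s2 u)).
  by have [] := tri Et0.
apply: nT; have [Y0 eY0 [S0 W0 Z0]] := inf t0 Et0.
apply: (tangent_infinity tT); first by exists Y0.
move=> N sN; have [t [Et tt0 tk Nt]] := rec N k sN k0.
have [Y eY [S1 W1 Z1]] := inf t Et.
exists (s3 t) => //; split; last by exists Y.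
move=> same.
have DD : D t = D t0.
  have : Y \in <[Y0]>%VS by rewrite -eY0 -same eY memv_line.
  case/vlineP => l el.
  have l0 : l != 0 by apply: contra W1 => /eqP l0; rewrite el l0 scale0r hw0.
  move: Z1; rewrite el hzZ hwZ => Z1.
  have k1 : l * (hz Y0 : C) != 0.
    rewrite mulf_neq0 //; apply: contra W0 => /eqP zz; move/eqP: Z0.
    by rewrite zz mul0r eq_sym mulf_eq0 expf_eq0 (negPf m20) andbF.
  by apply: (mulfI k1); rewrite Z1 -[in RHS]mulrA Z0; ring.
have := Hk t tt0 tk; rewrite -/(D t) -/(D t0) DD subrr mulr0 sub0r normrN.
by rewrite ltxx.
Qed.
End Slices.

(** * Open families of triangles *)

Section Families.
Variable R : realType.
Local Notation C := (Cplx R).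

Lemma arc_in_sub (a : analytic_curve R) V s D D' z w p m n :
  @arc_in R a V s D z w p m n -> open D' -> D' !=set0 -> D' `<=` D ->
  arc_in V s D' z w p m n.
Proof.
move=> [oD _ arc der] oD' D0 sub; split; [exact: oD'|exact: D0| |].
  by move=> t /sub; exact: arc.
exact: arc_derivatives_sub der.
Qed.

Variables (a b c : analytic_curve R) (V1 : set a) (s1 : C -> a)
  (z1 w1 p1 m1 n1 : C -> C) (V2 : set b) (s2 : C -> b) (z2 w2 p2 m2 n2 : C -> C).

Definition family (E F : set C) :=
  [/\ arc_in V1 s1 E z1 w1 p1 m1 n1, arc_in V2 s2 F z2 w2 p2 m2 n2 &
    forall t u, E t -> F u -> exists q : c, triangle (s1 t) (s2 u) q].

Lemma family_box E F (f : C -> C -> C) t u : family E F -> E t -> F u ->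
  jointly_continuous f t u -> f t u != 0 ->
  exists E' F', [/\ family E' F', E' t /\ F' u, E' `<=` E /\ F' `<=` F &
    forall x y, E' x -> F' y -> f x y != 0].
Proof.
move=> [A1 A2 tri] Et Fu cf f0.
have [oE _ _ _] := A1; have [oF _ _ _] := A2.
have [E' [F' [[oE' Et' sE] [oF' Fu' sF] H]]] := nonzero_box oE oF Et Fu cf f0.
exists E', F'; split; [split|by []|by []|exact: H].
- exact: (arc_in_sub A1 oE' (ex_intro _ t Et') sE).
- exact: (arc_in_sub A2 oF' (ex_intro _ u Fu') sF).
- by move=> x y /sE Ex /sF Fy; exact: tri.
Qed.

Lemma family_jc E F : family E F -> forall t u, E t -> F u ->
  [/\ jointly_continuous (fun t u => z2 u - z1 t) t u,
      jointly_continuous (fun t u => w2 u - w1 t) t u,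
      jointly_continuous (fun t u => m1 t) t u & jointly_continuous (fun t u => m2 u) t u].
Proof.
move=> [[_ _ _ d1] [_ _ _ d2] _] t u Et Fu.
have [dz1 dw1 dm1 _] := d1 t Et; have [dz2 dw2 dm2 _] := d2 u Fu.
split.
- apply: jcB; first by apply: jc_snd; exact: (is_derive_continuous dz2).
  apply: jc_fst; exact: (is_derive_continuous dz1).
- apply: jcB; first by apply: jc_snd; exact: (is_derive_continuous dw2).
  apply: jc_fst; exact: (is_derive_continuous dw1).
- apply: jc_fst; exact: (is_derive_continuous dm1).
- apply: jc_snd; exact: (is_derive_continuous dm2).
Qed.

Lemma third_choice E F u : family E F -> F u ->
  exists s3 : C -> c, forall t, E t -> triangle (s1 t) (s2 u) (s3 t).
Proof.
move=> [[_ [t0 Et0] _ _] _ tri] Fu; have [q0 _] := tri t0 u Et0 Fu.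
have P t : exists q : c, E t -> triangle (s1 t) (s2 u) q.
  have [Et|nE] := pselect (E t); last by exists q0.
  by have [q Hq] := tri t u Et Fu; exists q.
by have [s3 H] := choice P; exists s3.
Qed.
End Families.

Section NoFamily.
Variable R : realType.
Local Notation C := (Cplx R).
Variables (a b c : analytic_curve R) (V1 : set a) (s1 : C -> a)
  (z1 w1 p1 m1 n1 : C -> C) (V2 : set b) (s2 : C -> b) (z2 w2 p2 m2 n2 : C -> C).
Let fam := family c V1 s1 z1 w1 p1 m1 n1 V2 s2 z2 w2 p2 m2 n2.

Lemma familyC E F : fam E F -> family c V2 s2 z2 w2 p2 m2 n2 V1 s1 z1 w1 p1 m1 n1 F E.
Proof.
move=> [A1 A2 tri]; split; [exact: A2|exact: A1|move=> t u Ft Eu].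
by have [q /triangleC Hq] := tri u t Eu Ft; exists q.
Qed.

Lemma no_generic_family E F : fam E F ->
  (forall t u, E t -> F u -> z2 u - z1 t != 0) ->
  (forall t u, E t -> F u -> w2 u - w1 t != 0) ->
  (forall t u, E t -> F u -> m1 t ^+ 2 - m2 u ^+ 2 != 0) -> False.
Proof.
move=> H dz dw dm; have [A1 A2 tri] := H.
have [oE E0 _ d1] := A1; have [oF F0 _ d2] := A2.
have dm' t u : E t -> F u -> m1 t ^+ 2 != m2 u ^+ 2.
  by move=> Et Fu; rewrite -subr_eq0; exact: dm.
apply: (@no_curvature_box _ E F z1 w1 p1 m1 n1 z2 w2 p2 m2 n2 oE oF E0 F0 d1 d2).
- move=> t u Et Fu; have [q tr] := tri t u Et Fu.
  have [_ _ _ [h1 h2]] := third_vertex A1 A2 Et Fu tr (dz t u Et Fu) (dw t u Et Fu) (dm' t u Et Fu).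
  by split; [rewrite mulf_neq0 ?invr_eq0 ?dz ?dw | exact: dw | exact: dm' | exact: h1 | exact: h2].
- move=> t u Et Fu; have [s3 tr] := third_choice H Fu.
  apply: (curvature_defect_slice A1 A2 Fu _ _ tr _ Et) => x Ex; [exact: dz|exact: dw|exact: dm'].
- move=> t u Et Fu; have [s3 tr] := third_choice (familyC H) Et.
  have De : (z2 u - z1 t) / (w2 u - w1 t) = (z1 t - z2 u) / (w1 t - w2 u).
    by rewrite -[z2 u - _]opprB -[w2 u - _]opprB invrN mulrNN.
  rewrite De opprB; apply: (curvature_defect_slice A2 A1 Et _ _ tr _ Fu) => x Fx.
  + by rewrite -oppr_eq0 opprB; exact: dz.
  + by rewrite -oppr_eq0 opprB; exact: dw.
  + by rewrite eq_sym; exact: dm'.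
Qed.

(** Unless D^2 = m1^2 on the whole box, [no_parallel] applies to a smaller one.  In
    the exceptional case, (z2 - z1)^2 = m1^2 (w2 - w1)^2 can be differentiated in
    u: the side would be tangent to the second mirror. *)
Lemma no_parallel_family E F : fam E F ->
  (forall t u, E t -> F u -> z2 u - z1 t != 0) ->
  (forall t u, E t -> F u -> w2 u - w1 t != 0) ->
  (forall t u, E t -> F u -> m1 t ^+ 2 = m2 u ^+ 2) -> False.
Proof.
move=> H dz dw dm; have [A1 A2 tri] := H.
pose D t u := (z2 u - z1 t) / (w2 u - w1 t).
have [[t [u [Et Fu ne]]]|none] := pselect (exists t u, [/\ E t, F u & D t u ^+ 2 - m1 t ^+ 2 != 0]).
  have [jz jw jm _] := family_jc H Et Fu.
  have jV := @jcV _ (fun x y => w2 y - w1 x) t u (dw t u Et Fu) jw.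
  have jD : jointly_continuous D t u by exact: (jcM jz jV).
  have jf : jointly_continuous (fun x y => D x y ^+ 2 - m1 x ^+ 2) t u.
    by apply: jcB; [exact: (jcM jD jD)|exact: (jcM jm jm)].
  have [E' [F' [H' [Et' Fu'] [sE sF] nz]]] := family_box H Et Fu jf ne.
  have [A1' A2' _] := H'; have [s3 tr] := third_choice H' Fu'.
  apply: (no_parallel A1' A2' Fu' _ _ tr) => [x Ex|x Ex||x Ex|x Ex].
  - exact: dz (sE x Ex) Fu.
  - exact: dw (sE x Ex) Fu.
  - by exists t.
  - exact: dm (sE x Ex) Fu.
  - by rewrite -subr_eq0; exact: nz.
have [oE [t Et] _ _] := A1; have [oF [u Fu] _ d2] := A2.
have [q tr] := tri t u Et Fu; have [Y eY _] := CP2_generator (curve_map q).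
have [_ _] := third_vertex_law A1 A2 Et Fu tr eY; apply.
have [dz2 dw2 _ [_ _ p20 m20]] := d2 u Fu.
have G := is_derive_subf (is_derive_sqrf (is_derive_subf dz2 (is_derive_constf u (z1 t))))
  (is_derive_mulf (is_derive_constf u (m1 t ^+ 2)) (is_derive_sqrf (is_derive_subf dw2 (is_derive_constf u (w1 t))))).
have Z x : F x -> (z2 x - z1 t) ^+ 2 - m1 t ^+ 2 * (w2 x - w1 t) ^+ 2 = 0.
  move=> Fx; have D0 : D t x ^+ 2 - m1 t ^+ 2 = 0.
    by apply/eqP/negPn/negP => ne; apply: none; exists t, x.
  have -> : z2 x - z1 t = D t x * (w2 x - w1 t) by rewrite /D divfK //; exact: dw.
  by rewrite exprMn -mulrBl D0 mul0r.
have := derive_zero oF Fu Z G; rewrite (dm t u Et Fu) => E1.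
have k0 : 2 * p2 u * m2 u != 0 by rewrite !mulf_neq0 ?pnatr_eq0.
apply/eqP; rewrite -subr_eq0; apply/eqP; apply: (mulIf k0); rewrite mul0r -[RHS]E1.
ring.
Qed.

(** The differences z2 - z1 and w2 - w1 cannot vanish on a box, as the velocity of
    the first vertex has non-zero isotropic coordinates; so a smaller box avoids
    isotropic sides. *)
Lemma no_triangle_family E F : ~ fam E F.
Proof.
move=> H0.
have [E1 [F1 [H1 dz]]] : exists E' F', fam E' F' /\ forall t u, E' t -> F' u -> z2 u - z1 t != 0.
  have [A1 A2 _] := H0; have [oE [t Et] _ d1] := A1; have [_ [u Fu] _ _] := A2.
  have [[t' [u' [Et' Fu' ne]]]|none] := pselect (exists t u, [/\ E t, F u & z2 u - z1 t != 0]).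
    have [jz _ _ _] := family_jc H0 Et' Fu'.
    by have [E' [F' [H' _ _ nz]]] := family_box H0 Et' Fu' jz ne; exists E', F'.
  have [dz1 _ _ [_ _ p10 m10]] := d1 t Et.
  have Z x : E x -> z2 u - z1 x = 0.
    by move=> Ex; apply/eqP/negPn/negP => ne; apply: none; exists x, u.
  have /eqP := derive_zero oE Et Z (is_derive_subf (is_derive_constf t (z2 u)) dz1).
  by rewrite sub0r oppr_eq0 mulf_eq0 (negPf p10) (negPf m10).
have [E2 [F2 [H2 [dz2 dw]]]] : exists E' F', fam E' F' /\
   (forall t u, E' t -> F' u -> z2 u - z1 t != 0) /\
   (forall t u, E' t -> F' u -> w2 u - w1 t != 0).
  have [A1 A2 _] := H1; have [oE [t Et] _ d1] := A1; have [_ [u Fu] _ _] := A2.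
  have [[t' [u' [Et' Fu' ne]]]|none] := pselect (exists t u, [/\ E1 t, F1 u & w2 u - w1 t != 0]).
    have [_ jw _ _] := family_jc H1 Et' Fu'.
    have [E' [F' [H' _ [sE sF] nz]]] := family_box H1 Et' Fu' jw ne; exists E', F'.
    by split; [exact: H'|split=> [x y /sE Ex /sF Fy|]; [exact: dz|exact: nz]].
  have [_ dw1 _ [_ _ p10 _]] := d1 t Et.
  have Z x : E1 x -> w2 u - w1 x = 0.
    by move=> Ex; apply/eqP/negPn/negP => ne; apply: none; exists x, u.
  have /eqP := derive_zero oE Et Z (is_derive_subf (is_derive_constf t (w2 u)) dw1).
  by rewrite sub0r oppr_eq0 (negPf p10).
have [[t [u [Et Fu ne]]]|none] := pselect (exists t u, [/\ E2 t, F2 u & m1 t ^+ 2 - m2 u ^+ 2 != 0]).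
  have [_ _ jm1 jm2] := family_jc H2 Et Fu.
  have jf : jointly_continuous (fun x y => m1 x ^+ 2 - m2 y ^+ 2) t u.
    by apply: jcB; [exact: (jcM jm1 jm1)|exact: (jcM jm2 jm2)].
  have [E' [F' [H' _ [sE sF] nz]]] := family_box H2 Et Fu jf ne.
  apply: (no_generic_family H' _ _ nz) => x y /sE Ex /sF Fy; [exact: dz2|exact: dw].
apply: (no_parallel_family H2 dz2 dw) => t u Et Fu.
by apply/eqP; rewrite -subr_eq0; apply/negPn/negP => ne; apply: none; exists t, u.
Qed.
End NoFamily.

Definition third_ix : 'I_3 := Ordinal (isT : (2 < 3)%N).

Lemma orbit_triangle (R : realType) (a : billiard R 3) (s : forall j, a j) : periodic_orbit s ->
  triangle (s (first_ix 1)) (s (second_ix 1)) (s third_ix).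
Proof.
move=> orb; pose A i := curve_map (s i).
have S1 : ordS (first_ix 1) = second_ix 1 by exact/val_inj.
have S2 : ordS (second_ix 1) = third_ix by exact/val_inj.
have S3 : ordS third_ix = first_ix 1 by exact/val_inj.
have P1 : ord_pred (first_ix 1) = third_ix by exact/val_inj.
have P2 : ord_pred (second_ix 1) = first_ix 1 by exact/val_inj.
have P3 : ord_pred third_ix = second_ix 1 by exact/val_inj.
have refl j : reflects_at (s j) (A (ord_pred j)) (A (ordS j)).
  have [_ [T [tT nT iT oT sym]]] := orb j.
  by exists T; split=> //; rewrite ?(line_throughC (curve_map (s j)) (A (ord_pred j))).
have ne j : A j <> A (ordS j) by have [] := orb j.
split.
- have n1 := ne (first_ix 1); have n2 := ne (second_ix 1); have n3 := ne third_ix.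
  rewrite S1 in n1; rewrite S2 in n2; rewrite S3 in n3.
  by split=> // h; apply: n3.
- by have := refl (first_ix 1); rewrite P1 S1; exact: reflects_atC.
- by have := refl (second_ix 1); rewrite P2 S2.
- by have := refl third_ix; rewrite P3 S3; exact: reflects_atC.
Qed.

Theorem theorem1p8 (R : realType) (a : billiard R 3) : ~ reflective a.
Proof.
case=> U [oU [x0 Ux0] orb].
have [[V1 V2] /= [V1x V2x] V12] : nbhs x0 U by exact: open_nbhs_nbhs.
have tri q1 q2 : V1 q1 -> V2 q2 -> exists q3 : a third_ix, triangle q1 q2 q3.
  move=> Vq1 Vq2; have [s [po e1 e2]] := orb (q1, q2) (V12 (q1, q2) (conj Vq1 Vq2)).
  by exists (s third_ix); have := orbit_triangle po; rewrite e1 e2.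
have tan1 q : (V1°) q -> exists2 T, tangent_line q T & ~ isotropic T.
  move=> /interior_subset Vq; have [q3 [_ [T [tT nT _ _ _]] _ _]] := tri q _ Vq (nbhs_singleton V2x).
  by exists T.
have tan2 q : (V2°) q -> exists2 T, tangent_line q T & ~ isotropic T.
  move=> /interior_subset Vq; have [q3 [_ _ [T [tT nT _ _ _]] _]] := tri _ q (nbhs_singleton V1x) Vq.
  by exists T.
have [s1 [E [z1 [w1 [p1 [m1 [n1 A1]]]]]]] := exists_arc (@open_interior _ V1) (ex_intro _ x0.1 V1x) tan1.
have [s2 [F [z2 [w2 [p2 [m2 [n2 A2]]]]]]] := exists_arc (@open_interior _ V2) (ex_intro _ x0.2 V2x) tan2.
apply: (@no_triangle_family R _ _ (a third_ix) _ s1 z1 w1 p1 m1 n1 _ s2 z2 w2 p2 m2 n2 E F).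
split; [exact: A1|exact: A2|move=> t u Et Fu].
have [_ _ /(_ t Et)[/interior_subset Vt _ _] _] := A1.
have [_ _ /(_ u Fu)[/interior_subset Vu _ _] _] := A2.
exact: tri.
Qed.
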